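(* Consider any one of the following systems of ordinary differential equations $\dot z^\alpha=F^\alpha_{ij}\dot y^i\dot y^j$ with constant real coefficients: (I) $\dot z^i=\dot y^0\dot y^i$, $1\le i\le\ell-2$, $\ell\ge3$; (II) $\dot z^{ij}=\dot y^i\dot y^j$, $1\le i\le j\le\ell-1$, $\ell\ge3$; (III) $\dot z=\frac12\sum_{i,j=1}^{2\ell-3}\kappa_{ij}\dot y^i\dot y^j$, $\ell\ge3$; (IV) $\dot z=\frac12\sum_{i,j=1}^{2\ell-4}\kappa_{ij}\dot y^i\dot y^j$, $\ell\ge3$; where $(\kappa_{ij})$ is a symmetric non-degenerate constant real matrix of arbitrary signature. Then every infinitesimal symmetry $$X=A\frac{\partial}{\partial x}+B^i\frac{\partial}{\partial y^i}+C^\alpha\frac{\partial}{\partial z^\alpha}+D^i\frac{\partial}{\partial \dot y^i}$$ of the system is a prolonged point symmetry: the coefficients $A,B^i,C^\alpha$ do not depend on the variables $\dot y^j$, and $$D^i=D_xB^i-\dot y^iD_xA,\qquad D_x=\frac{\partial}{\partial x}+\dot y^i\frac{\partial}{\partial y^i}+F^\alpha_{ij}\dot y^i\dot y^j\frac{\partial}{\partial z^\alpha}.$$ Moreover $A,B^i,C^\alpha$ are quadratic functions (polynomials of degree at most two) of the variables $x,y^i,z^\alpha$.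
   Context: Summation over repeated indices is understood; $y^i$ ranges over all the dependent variables of $y$-type in the system ($y^0,\dots,y^{\ell-2}$ in (I); $y^1,\dots,y^{\ell-1}$ in (II); $y^1,\dots,y^{2\ell-3}$ in (III); $y^1,\dots,y^{2\ell-4}$ in (IV)), $z^\alpha$ over all those of $z$-type. For a system $\dot z^\alpha=F^\alpha(x,y^i,\dot y^i,z^\alpha)$, an infinitesimal symmetry is a smooth vector field $X$ on the space with independent coordinates $(x,y^i,z^\alpha,\dot y^i)$ which preserves the Pfaffian system $\mathcal I=\mathrm{span}\{dy^i-\dot y^i\,dx,\ dz^\alpha-F^\alpha\,dx\}$, i.e. $\mathcal L_X\theta\in\mathcal I$ for every $\theta\in\mathcal I$ (span over smooth functions). *)

(* Defs.v *)
From mathcomp Require Import all_boot all_order all_algebra.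
From mathcomp Require Import all_classical all_reals all_analysis.
(* The notations of mpoly clash with those of the analysis library. *)
From mathcomp Require Import -(notations) mpoly.

Set Implicit Arguments.
Unset Strict Implicit.
Unset Printing Implicit Defensive.

Import Order.TTheory GRing.Theory Num.Theory.
Import numFieldNormedType.Exports.

Local Open Scope ring_scope.
Local Open Scope classical_set_scope.

(* f is C^(k+1) iff it is differentiable and all its directional derivatives
   are C^k. *)
Fixpoint Ck (R : realType) (V W : normedModType R) (k : nat) (f : V -> W) : Prop :=
  match k with
  | 0%N => continuous f
  | k'.+1 => (forall q, differentiable f q) /\ (forall v, Ck k' (fun q => 'D_v f q))
  end.

Definition smooth (R : realType) (V W : normedModType R) (f : V -> W) : Prop :=
  forall k, Ck k f.

(* The system z'^a = sum_(i, j) (qs_F a) i j * y'^i * y'^j. *)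
Record quad_system (R : realType) := QuadSystem {
  qs_ny : nat;
  qs_nz : nat;
  qs_F : 'I_qs_nz -> 'M[R]_qs_ny
}.
Arguments QuadSystem {R qs_ny qs_nz} qs_F.

(* Coordinates (x, y^i, z^a, y'^i), in this order. *)
Definition jet_space (R : realType) (S : quad_system R) : normedModType R :=
  (R * 'rV[R]_(qs_ny S) * 'rV[R]_(qs_nz S) * 'rV[R]_(qs_ny S))%type.

Section Coordinates.
Context {R : realType} {S : quad_system R}.
Implicit Types (q v : jet_space S) (i : 'I_(qs_ny S)) (a : 'I_(qs_nz S)).

(* The coordinate functions are linear, so each is also its own differential:
   cx v = dx(v), cy i v = dy^i(v), and so on, for a tangent vector v. *)
Definition cx q : R := q.1.1.1.
Definition cy i q : R := q.1.1.2 0 i.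
Definition cz a q : R := q.1.2 0 a.
Definition cp i q : R := q.2 0 i.

Definition vec_x : jet_space S := (1, 0, 0, 0).
Definition vec_y i : jet_space S := (0, delta_mx 0 i, 0, 0).
Definition vec_z a : jet_space S := (0, 0, delta_mx 0 a, 0).

Definition Frhs a q : R := \sum_i \sum_j qs_F a i j * cp i q * cp j q.

Definition Dx (f : jet_space S -> R) q : R :=
  'D_vec_x f q + \sum_i cp i q * 'D_(vec_y i) f q + \sum_a Frhs a q * 'D_(vec_z a) f q.

(* A one-form is given by its values theta q v on tangent vectors v at q. *)
Definition one_form := jet_space S -> jet_space S -> R.

Definition contact_y i : one_form := fun q v => cy i v - cp i q * cx v.
Definition contact_z a : one_form := fun q v => cz a v - Frhs a q * cx v.

Definition in_pfaffian (theta : one_form) : Prop :=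
  exists (f : 'I_(qs_ny S) -> jet_space S -> R) (g : 'I_(qs_nz S) -> jet_space S -> R),
    [/\ forall i, smooth (f i), forall a, smooth (g a) &
        forall q v, theta q v = \sum_i f i q * contact_y i q v
                              + \sum_a g a q * contact_z a q v].

(* (L_X theta)(v) = X(theta(v)) - theta([X, v]) where, v being constant,
   [X, v] = - D_v X. *)
Definition lie_derivative (X : jet_space S -> jet_space S) (theta : one_form) : one_form :=
  fun q v => 'D_(X q) (fun q' => theta q' v) q + theta q ('D_v X q).

Definition infinitesimal_symmetry (X : jet_space S -> jet_space S) : Prop :=
  smooth X /\
  forall theta, in_pfaffian theta -> in_pfaffian (lie_derivative X theta).

Definition base_coords q : 'rV[R]_(1 + qs_ny S + qs_nz S) :=
  row_mx (row_mx (cx q)%:M q.1.1.2) q.1.2.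

Definition indep_of_ydot (f : jet_space S -> R) : Prop :=
  forall q q', base_coords q = base_coords q' -> f q = f q'.

(* msize P is the total degree of P plus one (and 0 for P = 0). *)
Definition quadratic_in_base (f : jet_space S -> R) : Prop :=
  exists P : mpoly (1 + qs_ny S + qs_nz S) R,
    (msize P <= 3)%N /\
    forall q, f q = meval (fun k => base_coords q 0 k) P.

End Coordinates.

(* The indices are y^0, ..., y^(l-2), as in 'I_(l - 1), and z^1, ..., z^(l-2),
   so that a : 'I_(l - 2) stands for z^(a+1). *)
Definition systemI (R : realType) (l : nat) : quad_system R :=
  QuadSystem (fun a : 'I_(l - 2) =>
    \matrix_(i < (l - 1)%N, j < (l - 1)%N)
      ((val i == 0%N) && (val j == (val a).+1))%:R).

Definition ordered_pair (n : nat) : finType :=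
  {ij : 'I_n * 'I_n | (ij.1 <= ij.2)%N}.

(* In systems II to IV the index i >= 1 is the ordinal i - 1; here the
   z-variables are indexed through the enumeration of the pairs i <= j. *)
Definition systemII (R : realType) (l : nat) : quad_system R :=
  QuadSystem (fun a : 'I_#|ordered_pair (l - 1)| =>
    let ij := val (enum_val a) in delta_mx ij.1 ij.2 : 'M[R]_(l - 1)).

Definition system_kappa (R : realType) (n : nat) (kappa : 'M[R]_n) : quad_system R :=
  QuadSystem (fun _ : 'I_1 => 2^-1 *: kappa).

Inductive listed_system (R : realType) (l : nat) : quad_system R -> Prop :=
| ListedI : listed_system l (systemI R l)
| ListedII : listed_system l (systemII R l)
| ListedIII (kappa : 'M[R]_(2 * l - 3)) :
    kappa^T = kappa -> kappa \in unitmx -> listed_system l (system_kappa kappa)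
| ListedIV (kappa : 'M[R]_(2 * l - 4)) :
    kappa^T = kappa -> kappa \in unitmx -> listed_system l (system_kappa kappa).

(* Main.v *)
(* Evaluating L_X theta, for the generators theta of the Pfaffian system, on
   d/dy'^j gives dB^i/dy'^j = y'^i dA/dy'^j and dC^a/dy'^j = F^a dA/dy'^j.  Hence
   B^i - y'^i A depends on y'^i only among the fibre coordinates and A is minus
   its y'^i-derivative; having two indices i at hand, A, and then B and C, do not
   depend on y'.  Evaluation on D_x gives the formula for D^i, and shows that the
   field Y = (A, B, C) on the (x, y, z)-space has the following property: the
   derivative of Y along (1, p, F(p)) is tangent at (1, p, F(p)) to the cone over
   these vectors, for all p.  This cone is the cone of rank one 2 x (l-1) matrices
   in case I, that of rank one symmetric l x l matrices in case II, and the null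
   cone of a quadratic form in cases III and IV.  In each case a symmetric
   trilinear map T for which every T(u, v, .) has this infinitesimal property is
   zero; applied to the third derivative of Y this shows, by Taylor's formula,
   that Y is quadratic. *)

From HB Require Import structures.
Require Import Defs.
From mathcomp Require Import all_boot all_order all_algebra.
From mathcomp Require Import all_classical all_reals all_analysis.
From mathcomp Require Import -(notations) mpoly.
From mathcomp Require Import zify ring lra.

Set Implicit Arguments.
Unset Strict Implicit.
Unset Printing Implicit Defensive.

Import Order.TTheory GRing.Theory Num.Theory.
Import numFieldNormedType.Exports.

Local Open Scope ring_scope.

(** * Directional derivatives, smoothness, equality of mixed derivatives, Taylor's formula of order
    two *)

Section Calculus.
Local Open Scope classical_set_scope.
Context {R : realType}.
Implicit Types U V W Z : normedModType R.

Lemma is_derive_line V W (f : V -> W) (q v : V) (t : R) :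
  derivable f (q + t *: v) v ->
  is_derive t 1 (fun s : R => f (q + s *: v)) ('D_v f (q + t *: v)).
Proof.
have E : (fun h : R => h^-1 *: (f (q + (h *: (1 : R) + t) *: v) - f (q + t *: v)))
       = (fun h : R => h^-1 *: (f (h *: v + (q + t *: v)) - f (q + t *: v))).
  apply/funext => h; congr (_ *: (f _ - _)).
  by rewrite (_ : h *: (1 : R) = h) ?scalerDl 1?addrCA//; exact: mulr1.
move=> df; split; first by rewrite /derivable E.
by rewrite /derive E.
Qed.

Lemma derive0_shift V (f : V -> R) (v : V) :
  (forall q, derivable f q v) -> (forall q, 'D_v f q = 0) ->
  forall q (t : R), f (q + t *: v) = f q.
Proof.
move=> df f0 q t; rewrite -[in RHS](addr0 q) -[in RHS](scale0r v).
apply: (@is_derive_0_is_cst _ (fun s => f (q + s *: v))) => s.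
by rewrite -(f0 (q + s *: v)); exact: is_derive_line.
Qed.

Lemma derive_comp_lin V W Z (l : {linear W -> Z}) (f : V -> W) (q v : V) :
  continuous l -> derivable f q v -> is_derive q v (l \o f) (l ('D_v f q)).
Proof.
move=> cl df.
have E : (fun h : R => h^-1 *: ((l \o f) (h *: v + q) - (l \o f) q))
   = (fun h => l (h^-1 *: (f (h *: v + q) - f q))).
  by apply/funext => h; rewrite (linearZ_LR l) (linearB l).
have H : (fun h : R => h^-1 *: ((l \o f) (h *: v + q) - (l \o f) q)) @ 0^'
   --> l ('D_v f q).
  by rewrite E; apply: continuous_cvg; [exact: cl | exact: df].
split; first by apply/cvg_ex; exists (l ('D_v f q)).
exact/cvg_lim.
Qed.

Lemma derive_precomp_lin U V W (j : {linear U -> V}) (f : V -> W) (q v : U) :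
  'D_v (f \o j) q = 'D_(j v) f (j q).
Proof.
rewrite /derive; under eq_fun do rewrite /= (linearD j) (linearZ_LR j).
by [].
Qed.

(** Induction on [k]: the derivative of [l \o f \o j] along [v] is [l \o D \o j], where [D] is the
    derivative of [f] along [j v], so it has the same shape. *)
Lemma Ck_comp_lin U V W Z (l : {linear W -> Z}) (j : {linear U -> V}) k (f : V -> W) :
  continuous l -> continuous j -> Ck k f -> Ck k (l \o f \o j).
Proof.
move=> cl cj; elim: k f => [|k IH] f /=.
  move=> cf q; apply: continuous_comp; first exact: cj.
  by apply: continuous_comp; [exact: cf | exact: cl].
move=> [df Df]; split=> [q|v].
  apply: differentiable_comp; first exact: linear_differentiable.
  by apply: differentiable_comp => //; exact: linear_differentiable.
suff -> : (fun q => 'D_v (l \o f \o j) q) = l \o (fun q => 'D_(j v) f q) \o j by exact/IH/Df.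
apply/funext => q; rewrite derive_precomp_lin /=.
have dfv : derivable f (j q) (j v) by exact/diff_derivable.
by have /@derive_val := derive_comp_lin cl dfv.
Qed.

Lemma smooth_comp_lin U V W Z (l : {linear W -> Z}) (j : {linear U -> V}) (f : V -> W) :
  continuous l -> continuous j -> smooth f -> smooth (l \o f \o j).
Proof. by move=> cl cj sf k; exact: Ck_comp_lin. Qed.

Lemma smooth_cst V W (c : W) : smooth (fun _ : V => c).
Proof.
move=> k; elim: k c => [|k IH] c /=; first exact: cst_continuous.
split=> [q|v]; first exact: differentiable_cst.
suff -> : (fun q : V => 'D_v (fun=> c) q) = (fun _ : V => 0 : W) by exact: IH.
by apply/funext => q; exact: derive_cst.
Qed.

Lemma smooth_diff V W (f : V -> W) q : smooth f -> differentiable f q.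
Proof. by move=> /(_ 1%N) []. Qed.

Lemma smooth_derivable V W (f : V -> W) q v : smooth f -> derivable f q v.
Proof. by move=> sf; exact/diff_derivable/smooth_diff. Qed.

Lemma smooth_derive V W (f : V -> W) v : smooth f -> smooth (fun q => 'D_v f q).
Proof. by move=> sf k; have [_ /(_ v)] := sf k.+1. Qed.

Lemma smooth_continuous V W (f : V -> W) : smooth f -> continuous f.
Proof. by move=> /(_ 0%N). Qed.

Lemma deriveDv V W (f : V -> W) q u v : differentiable f q ->
  'D_(u + v) f q = 'D_u f q + 'D_v f q.
Proof. by move=> df; rewrite !deriveE// linearD. Qed.

Lemma deriveZv V W (f : V -> W) q (c : R) v : differentiable f q ->
  'D_(c *: v) f q = c *: 'D_v f q.
Proof. by move=> df; rewrite !deriveE// linearZ. Qed.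

Lemma mean_value_line V (f : V -> R) (q v : V) (h : R) : 0 < h ->
  (forall q, differentiable f q) ->
  exists2 t, 0 < t < h & f (q + h *: v) - f q = h * 'D_v f (q + t *: v).
Proof.
move=> h0 df.
have dl (t : R) : is_derive t 1 (fun s : R => f (q + s *: v)) ('D_v f (q + t *: v)).
  exact/is_derive_line/diff_derivable.
have [|t tI E] := @MVT R (fun s => f (q + s *: v)) (fun t => 'D_v f (q + t *: v)) 0 h h0
  (fun t _ => dl t).
  by apply: derivable_within_continuous => x _.
exists t; first by move: tI; rewrite in_itv.
by move: E; rewrite scale0r addr0 subr0 mulrC.
Qed.

(** Two uses of the mean value theorem: along [u] for the difference [g] of [f] across [h *: v],
    then along [v] for the [u]-derivative of [f]. *)
Lemma second_difference V (f : V -> R) (q u v : V) (h : R) : 0 < h ->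
  (forall q, differentiable f q) -> (forall q, differentiable (fun q => 'D_u f q) q) ->
  exists s t, [/\ 0 < s < h, 0 < t < h &
    f (q + h *: u + h *: v) - f (q + h *: u) - (f (q + h *: v) - f q)
    = h * (h * 'D_v (fun q => 'D_u f q) (q + s *: u + t *: v))].
Proof.
move=> h0 df du.
pose g := fun x => f (x + h *: v) - f x.
have dsh (x : V) : differentiable (fun y => y + h *: v) x.
  by apply: differentiableD => //; exact: differentiable_cst.
have dfs (x : V) : differentiable (fun y => f (y + h *: v)) x.
  by apply: (@differentiable_comp _ _ _ _ (fun y => y + h *: v) f).
have dg x : differentiable g x by exact: differentiableB.
have [s sI E] := mean_value_line q u h0 dg.
have Dg : 'D_u g (q + s *: u) = 'D_u f (q + s *: u + h *: v) - 'D_u f (q + s *: u).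
  rewrite /g (@deriveB _ _ _ (fun y => f (y + h *: v)) f) //; last first.
  - exact/diff_derivable.
  - exact/diff_derivable.
  congr (_ - _); rewrite /derive.
  set x := q + s *: u.
  suff -> : (fun k : R => k^-1 *: (f (k *: u + x + h *: v) - f (x + h *: v)))
    = (fun k => k^-1 *: (f (k *: u + (x + h *: v)) - f (x + h *: v))) by [].
  by apply/funext => k; rewrite -!addrA.
have [t tI E2] := mean_value_line (q + s *: u) v h0 du.
exists s, t; split=> //.
have -> : f (q + h *: u + h *: v) - f (q + h *: u) - (f (q + h *: v) - f q)
  = g (q + h *: u) - g q by [].
by rewrite E Dg E2.
Qed.

(** Schwarz's theorem. The second difference is symmetric in [u] and [v], and it is h^2 times either
    mixed derivative at some point near [q]; were the two different at [q], continuity would keep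
    them apart for small h. *)
Lemma derive_comm V (f : V -> R) (u v : V) : smooth f ->
  forall q, 'D_u (fun q => 'D_v f q) q = 'D_v (fun q => 'D_u f q) q.
Proof.
move=> sf q; apply/eqP/negPn/negP => neq.
set G := fun q => 'D_v (fun q => 'D_u f q) q.
set H := fun q => 'D_u (fun q => 'D_v f q) q.
have cG : continuous G by apply: smooth_continuous; do 2 apply: smooth_derive.
have cH : continuous H by apply: smooth_continuous; do 2 apply: smooth_derive.
have e0 : 0 < `|G q - H q| / 2 by rewrite divr_gt0// normr_gt0 subr_eq0 eq_sym.
have nG : \forall x \near q, `|G q - G x| < `|G q - H q| / 2.
  by move/cvgrPdist_lt : (cG q) => /(_ _ e0).
have nH : \forall x \near q, `|H q - H x| < `|G q - H q| / 2.
  by move/cvgrPdist_lt : (cH q) => /(_ _ e0).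
have [d /= d0 Hd] := (iffLR (nbhs_ballP _ _) (filterI nG nH)).
(* With [h = d / K], a displacement by [s *: a + t *: b] with s, t < h has norm below h K = d, so
   both intermediate points lie in the ball. *)
pose K := `|u| + `|v| + 1.
have K0 : 0 < K by rewrite ltr_wpDl// addr_ge0.
pose h := d / K; have h0 : 0 < h by rewrite divr_gt0.
have near_q (s t : R) (a b : V) : 0 < s < h -> 0 < t < h -> `|a| + `|b| + 1 = K ->
    ball q d (q + s *: a + t *: b).
  move=> /andP[s0 sh] /andP[t0 th] Kab.
  rewrite -ball_normE /= -addrA opprD addNKr normrN.
  apply: (le_lt_trans (ler_normD _ _)); rewrite !normrZ !gtr0_norm//.
  have : s * `|a| + t * `|b| <= h * (`|a| + `|b|).
    by rewrite mulrDr lerD// ler_wpM2r// ltW.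
  move=> /le_lt_trans; apply.
  by rewrite -[ltRHS](divfK (lt0r_neq0 K0)) ltr_pM2l// -Kab ltrDl.
have df x : differentiable f x by exact: smooth_diff.
have du w x : differentiable (fun q => 'D_w f q) x by exact/smooth_diff/smooth_derive.
have [s1 [t1 [s1h t1h E1]]] := second_difference q v h0 df (du u).
have [s2 [t2 [s2h t2h E2]]] := second_difference q u h0 df (du v).
have E : G (q + s1 *: u + t1 *: v) = H (q + s2 *: v + t2 *: u).
  have hn0 : h != 0 by exact: lt0r_neq0.
  apply: (mulfI hn0); apply: (mulfI hn0).
  apply: etrans (esym E1) (etrans _ E2).
  rewrite (addrAC q (h *: v)).
  by move: (f q) (f (q + h *: u)) (f (q + h *: v)) (f _) => a b c d'; ring.
have [Hg _] := Hd _ (near_q s1 t1 u v s1h t1h erefl).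
have [_ Hh] := Hd _ (near_q s2 t2 v u s2h t2h (congr1 (+%R^~ 1) (addrC _ _))).
have : `|G q - H q| < `|G q - H q|.
  rewrite {2}[`|G q - H q|]splitr.
  apply: le_lt_trans (ltrD Hg Hh); rewrite E.
  by rewrite [X in _ <= _ + X]distrC; apply: ler_distD.
by rewrite ltxx.
Qed.

(** Along the line through 0 and [q] the second derivative is constant, hence the first is affine in
    the parameter and [f] is quadratic; the parameter value 1 gives the formula. *)
Lemma taylor2 V (f : V -> R) (q : V) : smooth f ->
  (forall x, 'D_q (fun x => 'D_q (fun x => 'D_q f x) x) x = 0) ->
  f q = f 0 + 'D_q f 0 + 2^-1 * 'D_q (fun x => 'D_q f x) 0.
Proof.
move=> sf f3.
have s1 := smooth_derive q sf; have s2 := smooth_derive q s1.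
pose d1 := fun x => 'D_q f x; pose d2 := fun x => 'D_q d1 x.
have c2 (t : R) : d2 (t *: q) = d2 0.
  by rewrite -[t *: q]add0r derive0_shift// => x; exact: smooth_derivable.
have c1 (t : R) : d1 (t *: q) - t * d2 0 = d1 0.
  rewrite -[RHS]subr0 -(mul0r (d2 0)) -[in d1 0](scale0r q).
  apply: (@is_derive_0_is_cst _ (fun t => d1 (t *: q) - t * d2 0)) => s.
  have H : is_derive s 1 (fun t : R => d1 (t *: q)) (d2 0).
    have := is_derive_line (smooth_derivable s1 : derivable _ (0 + s *: q) q).
    rewrite -/d1 -/(d2 _) add0r c2.
    by under eq_fun do rewrite add0r.
  have H2 : is_derive s 1 (fun t : R => t * d2 0) (d2 0).
    by apply: is_derive_eq; rewrite scaler0 add0r /GRing.scale /= mulr1.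
  by rewrite -(subrr (d2 0)); exact: is_deriveB.
pose g (t : R) := f (t *: q) - t * d1 0 - t ^+ 2 * (2^-1 * d2 0).
have g1 : g 1 = f q - d1 0 - 2^-1 * d2 0 by rewrite /g scale1r expr1n !mul1r.
have g0 : g 0 = f 0 by rewrite /g scale0r expr0n !mul0r !subr0.
suff : g 1 = g 0 by rewrite g1 g0 -/(d1 0) -/(d2 0) => <-; rewrite addrAC !subrK.
apply: is_derive_0_is_cst => s.
have H : is_derive s 1 (fun t : R => f (t *: q)) (d1 (s *: q)).
  have := is_derive_line (smooth_derivable sf : derivable _ (0 + s *: q) q).
  rewrite add0r -/(d1 _).
  by under eq_fun do rewrite add0r.
have E : d1 (s *: q) = d1 0 + s * d2 0 by rewrite -(c1 s) subrK.
rewrite /g; apply: is_derive_eq; rewrite E !scaler0 !add0r /GRing.scale /= !mulr1.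
move: (d1 0) (d2 0) => a b; by field.
Qed.

Lemma derive_lin V W (l : {linear V -> W}) (q v : V) :
  continuous l -> is_derive q v l (l v).
Proof.
move=> cl; have dq : derivable (id : V -> V) q v by exact: derivable_id.
have := derive_comp_lin cl dq.
by rewrite derive_id.
Qed.

Lemma derive_invariant V W (f : V -> W) (q v : V) :
  (forall t : R, f (q + t *: v) = f q) -> 'D_v f q = 0.
Proof.
move=> fq; rewrite /derive.
rewrite (_ : (fun h : R => _) = cst 0); first exact: lim_cst.
by apply/funext => h /=; rewrite (addrC (h *: v)) fq subrr scaler0.
Qed.

Lemma derive_invariant_shift V W (f : V -> W) (q v u : V) :
  (forall x, f (x + v) = f x) -> 'D_u f (q + v) = 'D_u f q.
Proof.
move=> fv; rewrite /derive fv.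
rewrite (_ : (fun h : R => _) = (fun h : R => h^-1 *: ((f \o shift q) (h *: u) - f q)))//.
by apply/funext => h /=; rewrite addrA fv.
Qed.

Lemma derive_comp_lin_fun V W (l : {linear W -> R}) (f : V -> W) v :
  continuous l -> smooth f ->
  (fun x => 'D_v (l \o f) x) = l \o (fun x => 'D_v f x).
Proof.
move=> cl sf; apply/funext => x.
have df : derivable f x v by exact: smooth_derivable.
by have /@derive_val := derive_comp_lin cl df.
Qed.

Lemma derive_lincomb V W (f g : V -> W) (c : R) q v : smooth f -> smooth g ->
  'D_v (fun x => c *: f x + g x) q = c *: 'D_v f q + 'D_v g q.
Proof.
move=> sf sg.
have df : derivable f q v by exact: smooth_derivable.
have dg : derivable g q v by exact: smooth_derivable.
rewrite (@deriveD _ _ _ (c \*: f) g)//; last exact: derivableZ.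
by rewrite deriveZ.
Qed.

Lemma smooth_lin_comp V W (l : {linear W -> R}) (f : V -> W) : continuous l -> smooth f ->
  smooth (l \o f).
Proof. by move=> cl sf; apply: (smooth_comp_lin (j := idfun) cl _ sf) => x. Qed.

End Calculus.

(** * Trilinear maps infinitesimally compatible with rank one matrices *)

Section SegreTensor.

(** Here [t u v w o] stands for the coefficient of T(e_u, e_v, e_w) at the matrix entry [o], entries
    being pairs (row, column). Apart from the diagonal coefficients, the last three conditions say
    that T(e_u, e_v, .) has the form M -> PM + MQ. *)
Definition segre_tensor (R : realFieldType) (I J : eqType)
    (t : I * J -> I * J -> I * J -> I * J -> R) : Prop :=
  [/\ forall u v w o, t u v w o = t v u w o,
      forall u v w o, t u v w o = t u w v o,
      forall u v a i b j, a != b -> i != j -> t u v (a, i) (b, j) = 0,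
      forall u v a b i j, a != b -> t u v (a, i) (b, i) = t u v (a, j) (b, j) &
      forall u v a b i j, i != j -> t u v (a, i) (a, j) = t u v (b, i) (b, j)].

(** Transposing the matrices exchanges the last two conditions, so a vanishing result about rows
    yields one about columns. *)
Lemma segre_tensor_swap (R : realFieldType) (I J : eqType)
    (t : I * J -> I * J -> I * J -> I * J -> R) :
  segre_tensor t ->
  segre_tensor (fun u v w o : J * I => t (u.2, u.1) (v.2, v.1) (w.2, w.1) (o.2, o.1)).
Proof.
move=> [s12 s23 H1 H2 H3]; split=> /=.
- by move=> u v w o; exact: s12.
- by move=> u v w o; exact: s23.
- by move=> u v a i b j ab ij; exact: H1.
- by move=> u v a b i j ab; exact: H3.
- by move=> u v a b i j ij; exact: H2.
Qed.

Lemma segre_tensor_eq0_aux (R : realFieldType) (I J : eqType)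
    (t : I * J -> I * J -> I * J -> I * J -> R) (a b c d : I) (i j k l m : J) :
  segre_tensor t -> m != l -> a != d -> c != d -> t (a, i) (b, j) (c, k) (d, l) = 0.
Proof.
move=> [s12 s23 H1 H2 H3] ml ad cd.
have [il|il] := eqVneq i l; last by rewrite s12 s23 H1.
have [kl|kl] := eqVneq k l; last by rewrite H1.
(* All columns are [l]: the third input and the output are moved together to the column [m]; then
   the first input differs from the output in both row and column. *)
by rewrite il kl (H2 _ _ c d l m cd) s12 s23 H1// eq_sym.
Qed.

Lemma segre_tensor_eq0 (R : realFieldType) (I J : eqType)
    (t : I * J -> I * J -> I * J -> I * J -> R) :
  (forall a : I, exists b, b != a) -> (forall i : J, exists j, j != i) ->
  segre_tensor t ->
  (forall u v a b i j, t u v (a, i) (a, i) - t u v (b, i) (b, i)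
                     = t u v (a, j) (a, j) - t u v (b, j) (b, j)) ->
  forall u v w o, t u v w o = 0.
Proof.
move=> otherI otherJ st H4.
have Z1 a b c d i j k l : a != d -> c != d -> t (a, i) (b, j) (c, k) (d, l) = 0.
  by have [m ml] := otherJ l; exact: segre_tensor_eq0_aux ml.
have Z2 a b c d i j k l : i != l -> k != l -> t (a, i) (b, j) (c, k) (d, l) = 0.
  have [e ed] := otherI d => il kl.
  exact: (@segre_tensor_eq0_aux _ _ _ _ i j k l a b c d e (segre_tensor_swap st) ed il kl).
case: st => s12 s23 H1 H2 H3.
have s13 u v w o : t u v w o = t w v u o by rewrite s12 s23 s12.
have caseA d l k : k != l -> t (d, l) (d, l) (d, k) (d, l) = 0.
  move=> kl; have [g gd] := otherI d.
  by rewrite (H3 _ _ d g k l kl) s23 Z1// eq_sym.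
have caseB d l g : g != d -> t (d, l) (d, l) (g, l) (d, l) = 0.
  move=> gd; have [k kl] := otherJ l.
  by rewrite (H2 _ _ g d l k gd) s23 Z2// eq_sym.
(* In the diagonal relation for rows [d], [g] and columns [l], [k], the other three terms vanish by
   [Z1] and [Z2]. *)
have caseO d l : t (d, l) (d, l) (d, l) (d, l) = 0.
  have [g gd] := otherI d; have [k kl] := otherJ l.
  have dg : d != g by rewrite eq_sym.
  have lk : l != k by rewrite eq_sym.
  move: (H4 (d, l) (d, l) d g l k).
  have -> : t (d, l) (d, l) (g, l) (g, l) = 0 by rewrite s23 Z1.
  have -> : t (d, l) (d, l) (d, k) (d, k) = 0 by rewrite s23 Z2.
  have -> : t (d, l) (d, l) (g, k) (g, k) = 0 by rewrite s23 Z1.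
  by rewrite !subr0.
(* The diagonal relation gives this coefficient as the negative of its mirror image under [d <-> g],
   [l <-> k], while sliding rows and columns gives it as equal to that image; hence it is zero. *)
have caseC d l g k : g != d -> k != l -> t (g, l) (d, k) (d, l) (d, l) = 0.
  move=> gd kl.
  have dg : d != g by rewrite eq_sym.
  have lk : l != k by rewrite eq_sym.
  have E : t (g, l) (d, k) (d, l) (d, l) = - t (d, k) (g, l) (g, k) (g, k).
    move: (H4 (g, l) (d, k) d g l k).
    have -> : t (g, l) (d, k) (g, l) (g, l) = 0 by rewrite s23 H1.
    have -> : t (g, l) (d, k) (d, k) (d, k) = 0 by rewrite s12 s23 H1.
    by rewrite subr0 sub0r => ->; rewrite s12.
  have E2 : t (g, l) (d, k) (d, l) (d, l) = t (d, k) (g, l) (g, k) (g, k).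
    rewrite s12 s23 (H2 _ _ g d l k gd) s23.
    by rewrite (H3 _ _ d g l k lk) s23.
  by move: E; rewrite E2; lra.
move=> [a i] [b j] [c k] [d l].
(* By [Z1] and [Z2], at most one input leaves the row [d] and at most one leaves the column [l]. If
   one input does both, [H1] applies; otherwise a permutation of the inputs leads to one of the four
   cases above. *)
have [ad|ad] := eqVneq a d; have [bd|bd] := eqVneq b d; have [cd|cd] := eqVneq c d;
  try by [rewrite Z1 | rewrite s12 Z1 | rewrite s23 Z1];
have [il|il] := eqVneq i l; have [jl|jl] := eqVneq j l; have [kl|kl] := eqVneq k l;
  try by [rewrite Z2 | rewrite s12 Z2 | rewrite s23 Z2];
  try by [rewrite H1 | rewrite s23 H1 | rewrite s13 H1];
  subst; try by [| rewrite caseA | rewrite s23 caseA | rewrite s13 caseA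
                 | rewrite caseB | rewrite s23 caseB | rewrite s13 caseB
                 | rewrite caseC | rewrite s12 caseC | rewrite s23 caseC
                 | rewrite s13 caseC | rewrite s12 s23 caseC | rewrite s23 s12 caseC].
Qed.

End SegreTensor.

(** * The (x, y, z)-space, the cone in it, and rigidity of the cone *)

Definition base_space (R : realType) (S : quad_system R) : normedModType R :=
  (R * 'rV[R]_(qs_ny S) * 'rV[R]_(qs_nz S))%type.

Section Base.
Context {R : realType} {S : quad_system R}.
Implicit Types (w : base_space S) (i : 'I_(qs_ny S)) (a : 'I_(qs_nz S))
  (p u : 'rV[R]_(qs_ny S)).

Definition bx w : R := w.1.1.
Definition by_ i w : R := w.1.2 0 i.
Definition bz a w : R := w.2 0 a.

Fact bx_linear : linear bx. Proof. by []. Qed.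
HB.instance Definition _ :=
  GRing.isLinear.Build R (base_space S) R *%R bx bx_linear.
Fact by_linear i : linear (by_ i). Proof. by move=> c v w; rewrite /by_ /= !mxE. Qed.
HB.instance Definition _ i :=
  GRing.isLinear.Build R (base_space S) R *%R (by_ i) (by_linear i).
Fact bz_linear a : linear (bz a). Proof. by move=> c v w; rewrite /bz /= !mxE. Qed.
HB.instance Definition _ a :=
  GRing.isLinear.Build R (base_space S) R *%R (bz a) (bz_linear a).

Lemma base_ext v w : bx v = bx w -> (forall i, by_ i v = by_ i w) ->
  (forall a, bz a v = bz a w) -> v = w.
Proof.
case: v w => [[x y] z] [[x' y'] z'] /= ex ey ez; congr (_, _, _).
- exact: ex.
- by apply/rowP => i; exact: ey.
- by apply/rowP => a; exact: ez.
Qed.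

Definition base_vx : base_space S := (1, 0, 0).
Definition base_vy i : base_space S := (0, delta_mx 0 i, 0).
Definition base_vz a : base_space S := (0, 0, delta_mx 0 a).

Lemma base_decomp w : w = bx w *: base_vx + \sum_i by_ i w *: base_vy i
  + \sum_a bz a w *: base_vz a.
Proof.
apply: base_ext => [|i|a].
- rewrite !(linearD bx) !(linear_sum bx) !big1 => [|a _|i _]; rewrite linearZ_LR /= ?mulr0//.
  by rewrite !addr0 /bx [RHS]mulr1.
- rewrite !(linearD (by_ i)) !(linear_sum (by_ i)) linearZ_LR /= (bigD1 i)//=.
  rewrite !linearZ_LR /=.
  rewrite !big1 => [|a _|j ji]; rewrite ?linearZ_LR /= /by_ /= !mxE ?mulr0//=.
    by rewrite !eqxx ?mulr0 mulr1 ?add0r ?addr0.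
  by rewrite eq_sym (negbTE ji) mulr0.
- rewrite !(linearD (bz a)) !(linear_sum (bz a)) linearZ_LR /=.
  rewrite [X in _ + X](bigD1 a)//= !linearZ_LR /=.
  rewrite !big1 => [|b ba|i _]; rewrite ?linearZ_LR /= /bz /= !mxE ?mulr0//=.
    by rewrite !eqxx ?mulr0 mulr1 ?add0r ?addr0.
  by rewrite eq_sym (negbTE ba) mulr0.
Qed.

Lemma continuous_bx : continuous bx.
Proof.
move=> w; rewrite /bx; apply: (@continuous_comp _ _ _ fst fst); exact: cvg_fst.
Qed.

Lemma continuous_by i : continuous (by_ i).
Proof.
move=> w; rewrite /by_.
apply: (@continuous_comp _ _ _ (fun w => w.1.2) (fun M : 'rV[R]_(qs_ny S) => M 0 i)).
  apply: (@continuous_comp _ _ _ fst snd); [exact: cvg_fst | exact: cvg_snd].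
exact: coord_continuous.
Qed.

Lemma continuous_bz a : continuous (bz a).
Proof.
move=> w; rewrite /bz.
apply: (@continuous_comp _ _ _ snd (fun M : 'rV[R]_(qs_nz S) => M 0 a)).
  exact: cvg_snd.
exact: coord_continuous.
Qed.

(** The matrix [qs_F a] may be non-symmetric, and so may this bilinear form; its polarization is the
    sum over both orders, as in [psi]. *)
Definition quad a p u : R := \sum_i \sum_j qs_F a i j * p 0 i * u 0 j.

Definition cone p : base_space S := (1, p, \row_a quad a p p).

(* The forms psi a p, for all a, cut out the tangent space at cone p of the
   (homogeneous) cone over the image of cone. *)
Definition psi a p w : R :=
  bz a w - (quad a p w.1.2 + quad a w.1.2 p) + quad a p p * bx w.

Lemma quad_linearl a u c p p' : quad a (c *: p + p') u = c * quad a p u + quad a p' u.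
Proof.
rewrite /quad mulr_sumr -big_split /=; apply: eq_bigr => i _.
rewrite mulr_sumr -big_split /=; apply: eq_bigr => j _.
by rewrite !mxE; ring.
Qed.

Lemma quad_linearr a u c p p' : quad a u (c *: p + p') = c * quad a u p + quad a u p'.
Proof.
rewrite /quad mulr_sumr -big_split /=; apply: eq_bigr => i _.
rewrite mulr_sumr -big_split /=; apply: eq_bigr => j _.
by rewrite !mxE; ring.
Qed.

Lemma quadDl a u p p' : quad a (p + p') u = quad a p u + quad a p' u.
Proof. by rewrite -[p]scale1r quad_linearl mul1r scale1r. Qed.

Lemma quadDr a u p p' : quad a u (p + p') = quad a u p + quad a u p'.
Proof. by rewrite -[p]scale1r quad_linearr mul1r scale1r. Qed.

Lemma quad0l a u : quad a 0 u = 0.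
Proof. by rewrite /quad big1// => i _; rewrite big1// => j _; rewrite mxE mulr0 mul0r. Qed.

Lemma quad0r a u : quad a u 0 = 0.
Proof. by rewrite /quad big1// => i _; rewrite big1// => j _; rewrite mxE mulr0. Qed.

Lemma quadZl a u c p : quad a (c *: p) u = c * quad a p u.
Proof. by rewrite -[c *: p]addr0 quad_linearl quad0l addr0. Qed.

Lemma quadZr a u c p : quad a u (c *: p) = c * quad a u p.
Proof. by rewrite -[c *: p]addr0 quad_linearr quad0r addr0. Qed.

Fact psi_linear a p : linear (psi a p).
Proof.
move=> c v w; rewrite /psi (linearP (bz a)) (linearP bx) quad_linearl quad_linearr.
by rewrite /GRing.scale /=; ring.
Qed.
HB.instance Definition _ a p :=
  GRing.isLinear.Build R (base_space S) R *%R (psi a p) (psi_linear a p).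

Definition sym_trilinear
    (T : base_space S -> base_space S -> base_space S -> base_space S) : Prop :=
  [/\ forall u v w : base_space S, T u v w = T v u w,
      forall u v w : base_space S, T u v w = T u w v
    & forall u v : base_space S, linear (T u v)].

(** The second prolongation of the Lie algebra of linear maps tangent to the cone is zero. *)
Definition rigid : Prop := forall T, sym_trilinear T ->
  (forall (u v : base_space S) a p, psi a p (T u v (cone p)) = 0) ->
  forall u v w : base_space S, T u v w = 0.

(** An expansion in the coordinate functions, from which continuity of [psi a p] is read off. *)
Lemma psi_coord a p w : psi a p w = bz a w
  - \sum_i (\sum_j (qs_F a i j + qs_F a j i) * p 0 j) * by_ i w + quad a p p * bx w.
Proof.
rewrite /psi; congr (_ - _ + _).
rewrite {1}/quad exchange_big /quad -big_split; apply: eq_bigr => i _ /=.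
rewrite -big_split mulr_suml; apply: eq_bigr => j _ /=.
by rewrite /by_; ring.
Qed.

Lemma continuous_psi a p : continuous (psi a p).
Proof.
move=> w; apply: differentiable_continuous.
have dM (f : base_space S -> R) (c : R) : differentiable f w ->
    differentiable (fun w => c * f w) w.
  by move=> df; apply: differentiableM => //; exact: differentiable_cst.
have dby i : differentiable (by_ i) w by apply: linear_differentiable; exact: continuous_by.
have -> : psi a p = (fun w => bz a w) \-
  (\sum_i (fun w => (\sum_j (qs_F a i j + qs_F a j i) * p 0 j) * by_ i w)) \+
  (fun w => quad a p p * bx w).
  by apply/funext => v; rewrite psi_coord /= fct_sumE.
apply: differentiableD; last first.
  by apply: dM; apply: linear_differentiable; exact: continuous_bx.
apply: differentiableB.
  by apply: linear_differentiable; exact: continuous_bz.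
by apply: differentiable_sum => i; exact: dM.
Qed.

End Base.
Arguments rigid {R} S.

(** * System I: rank one matrices with two rows *)

Section SystemI.
Context {R : realType} (k : nat).
(** With [l] written as [k.+3], the numbers [l - 1] and [l - 2] compute to [k.+2] and [k.+1]. *)
Local Notation S := (systemI R k.+3).
Implicit Types (w : base_space S) (b : bool) (i j : 'I_k.+2) (a : 'I_k.+1).

Lemma quad_systemI (a : 'I_k.+1) (p u : 'rV[R]_k.+2) :
  @quad R S a p u = p 0 0 * u 0 (lift ord0 a).
Proof.
rewrite /quad /= (bigD1 ord0) //= [X in _ + X]big1 => [|i i0]; last first.
  by apply: big1 => j _; rewrite mxE (negbTE i0 : (val i == 0%N) = false) /= !mul0r.
rewrite addr0 (bigD1 (lift ord0 a)) //= [X in _ + X]big1 => [|j ja]; last first.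
  rewrite mxE /= (_ : (j == a.+1 :> nat) = false) ?mul0r//.
  by apply/negbTE; apply: contra ja => /eqP ja; apply/eqP/val_inj.
by rewrite addr0 mxE /= /bump /= add1n eqxx mul1r.
Qed.

(* The base space as the space of 2 x k.+2 matrices, with rows (x, y^1, ...)
   and (y^0, z^1, ...); cone p is then the matrix of rank one given by the
   vectors (1, p_0) and (1, p_1, ...). *)
Definition segre_coord b i w : R :=
  if unlift ord0 i is Some a then (if b then bz (S := S) a w else by_ (S := S) i w)
  else if b then by_ (S := S) (ord0 : 'I_k.+2) w else bx w.

Definition segre_vec b i : base_space S :=
  if unlift ord0 i is Some a
  then (if b then (0, 0, delta_mx 0 a) else (0, delta_mx 0 i, 0))
  else if b then (0, delta_mx 0 i, 0) else (1, 0, 0).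

(** The matrix whose column [i] is (1, s) and whose other columns are zero. *)
Definition segre_col (s : R) i : base_space S := segre_vec false i + s *: segre_vec true i.

Lemma segre_coord_linear b i : linear (segre_coord b i).
Proof.
rewrite /segre_coord => c v w; case: unliftP => [a _|_]; case: b;
  [exact: bz_linear | exact: by_linear | exact: by_linear | exact: bx_linear].
Qed.
HB.instance Definition _ b i :=
  GRing.isLinear.Build R (base_space S) R *%R (segre_coord b i) (segre_coord_linear b i).

Lemma segre_vec0 b : segre_vec b ord0 = if b then (0, delta_mx 0 ord0, 0) else (1, 0, 0).
Proof. by rewrite /segre_vec unlift_none. Qed.

Lemma segre_vecS b a : segre_vec b (lift ord0 a) =
  if b then (0, 0, delta_mx 0 a) else (0, delta_mx 0 (lift ord0 a), 0).
Proof. by rewrite /segre_vec liftK. Qed.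

Lemma segre_coord0 b w : segre_coord b ord0 w =
  if b then by_ (S := S) (ord0 : 'I_k.+2) w else bx w.
Proof. by rewrite /segre_coord unlift_none. Qed.

Lemma segre_coordS b a w : segre_coord b (lift ord0 a) w =
  if b then bz (S := S) a w else by_ (S := S) (lift ord0 a) w.
Proof. by rewrite /segre_coord liftK. Qed.

Lemma segre_eq0 w : (forall b i, segre_coord b i w = 0) -> w = 0.
Proof.
move=> w0; apply: base_ext => [|i|a].
- by have := w0 false ord0; rewrite segre_coord0.
- rewrite [RHS]mxE; have [a|] := unliftP ord0 (i : 'I_k.+2) => ->.
    by have := w0 false (lift ord0 a); rewrite segre_coordS.
  by have := w0 true ord0; rewrite segre_coord0.
- by rewrite [RHS]mxE; have := w0 true (lift ord0 (a : 'I_k.+1)); rewrite segre_coordS.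
Qed.

Lemma segre_coord_vec b b' i j :
  segre_coord b' j (segre_vec b i) = ((b == b') && (i == j))%:R.
Proof.
have [a ->|->] := unliftP ord0 i; have [a' ->|->] := unliftP ord0 j;
rewrite ?segre_vec0 ?segre_vecS ?segre_coord0 ?segre_coordS;
case: b; case: b'; rewrite /bx /by_ /bz /= ?mxE //=;
by rewrite ?(inj_eq lift_inj) 1?eq_sym ?(inj_eq lift_inj).
Qed.

Lemma segre_decomp w :
  w = \sum_b \sum_i segre_coord b i w *: segre_vec b i.
Proof.
apply/eqP; rewrite -subr_eq0; apply/eqP; apply: segre_eq0 => c j.
rewrite linearB linear_sum /=; apply/eqP; rewrite subr_eq0; apply/eqP.
rewrite (bigD1 c)//= linear_sum (bigD1 j)//= linearZ_LR /= segre_coord_vec !eqxx mulr1.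
rewrite big1 => [|i ij]; last first.
  by rewrite linearZ_LR /= segre_coord_vec eqxx (negbTE ij) mulr0.
rewrite big1 ?addr0// => b bc.
rewrite linear_sum big1// => i _.
by rewrite linearZ_LR /= segre_coord_vec (negbTE bc) mulr0.
Qed.

Lemma cone_segre (s t : R) (a : 'I_k.+1) :
  @cone R S (s *: delta_mx 0 ord0 + t *: delta_mx 0 (lift ord0 a))
  = segre_col s ord0 + t *: segre_col s (lift ord0 a).
Proof.
rewrite /segre_col !segre_vec0 !segre_vecS; apply: base_ext => [|i|a'].
- by rewrite /bx /= !scaler0 !addr0 scaler0 addr0.
- by rewrite /by_ /= !scaler0 !add0r ?addr0.
- rewrite /bz /= !scaler0 ?add0r ?addr0 ?scaler0 mxE (quad_systemI a') !mxE /=.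
  by rewrite (inj_eq lift_inj); ring.
Qed.

(** The covector (-s, 1) applied to the column [i]; it kills every [segre_col s j]. *)
Definition segre_minor (s : R) i w : R := segre_coord true i w - s * segre_coord false i w.

Lemma segre_minor_linear s i : linear (segre_minor s i).
Proof.
move=> c v w; rewrite /segre_minor !(linearP (segre_coord _ i)).
by rewrite /GRing.scale /=; ring.
Qed.
HB.instance Definition _ s i :=
  GRing.isLinear.Build R (base_space S) R *%R (segre_minor s i) (segre_minor_linear s i).

Lemma psi_segre (s t : R) (a b : 'I_k.+1) w :
  @psi R S a (s *: delta_mx 0 ord0 + t *: delta_mx 0 (lift ord0 b)) w
  = segre_minor s (lift ord0 a) w - t * (a == b)%:R * segre_minor s ord0 w.
Proof.
rewrite /psi !(quad_systemI a) /segre_minor !segre_coordS !segre_coord0 !mxE /=.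
rewrite (inj_eq lift_inj) /by_ /bx /bz; ring.
Qed.

(** Modulo matrices with all columns proportional to (1, s), the map [L] sends each [segre_col s j]
    to a multiple of the column [j], with a factor common to all [j]. *)
Lemma segre_minor_col (L : {linear base_space S -> base_space S}) :
  (forall a p, @psi R S a p (L (@cone R S p)) = 0) ->
  forall s i j, segre_minor s i (L (segre_col s j))
    = (i == j)%:R * segre_minor s ord0 (L (segre_col s ord0)).
Proof.
move=> H s.
(* Tangency at the rank one matrix (1, s) times e_0 + t e_b is polynomial of degree two in [t]; its
   values at 0, 1, -1 determine the coefficients. *)
have E t (a b : 'I_k.+1) : segre_minor s (lift ord0 a) (L (segre_col s ord0))
   + t * segre_minor s (lift ord0 a) (L (segre_col s (lift ord0 b)))
   - t * (a == b)%:R * (segre_minor s ord0 (L (segre_col s ord0))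
     + t * segre_minor s ord0 (L (segre_col s (lift ord0 b)))) = 0.
  have := H a (s *: delta_mx 0 ord0 + t *: delta_mx 0 (lift ord0 b)).
  rewrite psi_segre cone_segre linearD linearZ_LR.
  by rewrite !(linearD (segre_minor s _)) !(linearZ_LR (segre_minor s _)).
move=> i j; have [a ->|->] := unliftP ord0 i; have [b ->|->] := unliftP ord0 j.
- move: (E 1 a b) (E 0 a b) (E (-1) a b); rewrite (inj_eq lift_inj).
  by case: (a == b); do !move: (segre_minor _ _ _) => ?; lra.
- by move: (E 0 a ord0); do !move: (segre_minor _ _ _) => ?; rewrite /=; lra.
- move: (E 1 b b) (E 0 b b) (E (-1) b b); rewrite eqxx.
  by do !move: (segre_minor _ _ _) => ?; rewrite /=; lra.
- by rewrite eqxx mul1r.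
Qed.

(** Both sides of [segre_minor_col] are polynomials of degree two in [s]; comparing coefficients
    gives the relations of [segre_tensor] and the one on the diagonal. *)
Lemma segre_coord_rel (L : {linear base_space S -> base_space S}) :
  (forall a p, @psi R S a p (L (@cone R S p)) = 0) ->
  let c b i b' j := segre_coord b' j (L (segre_vec b i)) in
  [/\ forall b i b' j, b != b' -> i != j -> c b i b' j = 0,
      forall b b' i j, b != b' -> c b i b' i = c b j b' j,
      forall b b' i j, i != j -> c b i b j = c b' i b' j
    & forall b b' i j, c b i b i - c b' i b' i = c b j b j - c b' j b' j].
Proof.
move=> H c.
have E s i j : c false j true i + s * (c true j true i - c false j false i)
     - s ^+ 2 * c true j false i = (i == j)%:R *
    (c false ord0 true ord0 + s * (c true ord0 true ord0 - c false ord0 false ord0)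
     - s ^+ 2 * c true ord0 false ord0).
  have := segre_minor_col H s i j.
  rewrite /segre_minor /segre_col !(linearD L) !(linearZ_LR L) !(linearD (segre_coord _ _)).
  rewrite !(linearZ_LR (segre_coord _ _)) -!/(c _ _ _ _) /GRing.scale /=.
  lra.
have E3 i j := (E 0 i j, E 1 i j, E (-1) i j).
split.
- move=> b i b' j bb' ij; case: (E3 j i); rewrite eq_sym (negbTE ij) => -[].
  by move: bb'; case: b; case: b' => //= _; lra.
- move=> b b' i j bb'; case: (E3 i i); case: (E3 j j); rewrite !eqxx => -[+ +] + [].
  by move: bb'; case: b; case: b' => //= _; lra.
- move=> b b' i j ij; case: (E3 j i); rewrite eq_sym (negbTE ij) => -[].
  by case: b; case: b' => //=; lra.
- move=> b b' i j; case: (E3 i i); case: (E3 j j); rewrite !eqxx => -[+ +] + [].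
  by case: b; case: b' => //=; lra.
Qed.

Lemma rigid_systemI : rigid S.
Proof.
move=> T [s12 s23 lT] psiT.
pose L u v : {linear base_space S -> base_space S} :=
  HB.pack (T u v) (GRing.isLinear.Build _ _ _ _ (T u v) (lT u v)).
pose e (bi : bool * 'I_k.+2) := segre_vec bi.1 bi.2.
pose t (u v w o : bool * 'I_k.+2) := segre_coord o.1 o.2 (T (e u) (e v) (e w)).
have rel u v := @segre_coord_rel (L u v) (psiT u v).
have t0 x y z o : t x y z o = 0.
  apply: segre_tensor_eq0.
  - by move=> b; exists (~~ b); case: b.
  - move=> i; have [->|i0] := eqVneq i ord0; first by exists ord_max.
    by exists ord0; rewrite eq_sym.
  - split.
    + by move=> *; rewrite /t s12.
    + by move=> *; rewrite /t s23.
    + by move=> u' v' b i b' j; case: (rel (e u') (e v')) => + _ _ _; exact.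
    + by move=> u' v' b b' i j; case: (rel (e u') (e v')) => _ + _ _; exact.
    + by move=> u' v' b b' i j; case: (rel (e u') (e v')) => _ _ + _; exact.
  - by move=> u' v' b b' i j; case: (rel (e u') (e v')) => _ _ _; exact.
(* Linearity in the last argument reduces it to basis vectors; the symmetries of [T] bring each
   argument to that place in turn. *)
have vec_eq0 u v : (forall b i, T u v (segre_vec b i) = 0) -> forall w, T u v w = 0.
  move=> H w; rewrite [w]segre_decomp; apply: etrans (linear_sum (L u v) _ _ _) _.
  rewrite big1// => b _; rewrite linear_sum big1// => i _.
  by rewrite linearZ_LR /= H scaler0.
move=> u v w; apply: (vec_eq0 _ _) => b i; rewrite s23; apply: (vec_eq0 _ _) => b' i'.
rewrite s12 s23 s12; apply: (vec_eq0 _ _) => c j.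
by apply: segre_eq0 => d l; exact: (t0 (b', i') (b, i) (c, j) (d, l)).
Qed.

End SystemI.

(** * System II: symmetric matrices of rank one *)

Section SystemII.
Context {R : realType} (l : nat).
Local Notation S := (systemII R l).
Implicit Types (w : base_space S) (i j : 'I_(l - 1)) (a : 'I_#|ordered_pair (l - 1)|)
  (p : 'rV[R]_(l - 1)).

Let pr a : 'I_(l - 1) * 'I_(l - 1) := val (enum_val a).

Lemma quad_systemII a p (u : 'rV[R]_(l - 1)) :
  @quad R S a p u = p 0 (pr a).1 * u 0 (pr a).2.
Proof.
rewrite /quad /= (bigD1 (pr a).1) //= [X in _ + X]big1 => [|i ni]; last first.
  by apply: big1 => j _; rewrite mxE (negbTE ni) !mul0r.
rewrite addr0 (bigD1 (pr a).2) //= [X in _ + X]big1 => [|j nj]; last first.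
  by rewrite mxE (negbTE nj) andbF !mul0r.
by rewrite addr0 mxE !eqxx mul1r.
Qed.

Let quad_row p (u : 'rV[R]_(l - 1)) : 'rV[R]_#|ordered_pair (l - 1)| :=
  \row_a @quad R S a p u.

Let base_mk (x : R) p (z : 'rV[R]_#|ordered_pair (l - 1)|) : base_space S := (x, p, z).

Lemma cone_shift p (u : 'rV[R]_(l - 1)) : @cone R S (p + u) =
  cone (S := S) p + base_mk 0 u (quad_row p u + quad_row u p)
  + base_mk 0 0 (quad_row u u).
Proof.
apply: base_ext => [|i|a].
- by rewrite /bx /= !addr0.
- by rewrite /by_ /= addr0.
- by rewrite /bz /= !mxE /= !quadDl !quadDr; ring.
Qed.

(** The cone points over a box of side 2 span the base space, stated dually. The side 2 leaves room
    for the increments e_i and e_i + e_j, including 2 e_i. *)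
Lemma cone_systemII_span (W : lmodType R) (L : {linear base_space S -> W}) (s : R) :
  (forall p, (forall i, s <= p 0 i <= s + 2) -> L (cone (S := S) p) = 0) ->
  forall w, L w = 0.
Proof.
move=> H.
pose p0 : 'rV[R]_(l - 1) := const_mx s.
(* The first and second order parts of [L] along the cone, expanded at the corner [p0] of the
   box. *)
pose N u := L (base_mk 0 u (quad_row p0 u + quad_row u p0)).
pose Z u u' := L (base_mk 0 0 (quad_row u u')).
have L0 : L (cone (S := S) p0) = 0 by apply: H => i; rewrite mxE; lra.
have LD (u : 'rV[R]_(l - 1)) : (forall i, 0 <= u 0 i <= 2) -> N u + Z u u = 0.
  move=> ur; have := H (p0 + u); rewrite cone_shift !linearD L0 add0r; apply.
  by move=> i; rewrite !mxE; have := ur i; lra.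
have ZD (u v : 'rV[R]_(l - 1)) : Z (u + v) (u + v) = Z u u + Z v v + (Z u v + Z v u).
  rewrite /Z -!linearD; congr (L (_, _, _)); rewrite /= ?addr0//.
  by apply/rowP => a; rewrite !mxE quadDl !quadDr; ring.
have ND (u v : 'rV[R]_(l - 1)) : N (u + v) = N u + N v.
  rewrite /N -linearD; congr (L (_, _, _)); rewrite /= ?addr0//.
  by apply/rowP => a; rewrite !mxE !quadDl !quadDr; ring.
have e_range i j : 0 <= (delta_mx 0 i : 'rV[R]_(l - 1)) 0 j <= 1.
  by rewrite mxE /=; case: (j == i) => /=; rewrite ?ler01 ?lexx.
have e1 i : N (delta_mx 0 i) + Z (delta_mx 0 i) (delta_mx 0 i) = 0.
  by apply: LD => j; have := e_range i j; lra.
have e2 i j : Z (delta_mx 0 i) (delta_mx 0 j) + Z (delta_mx 0 j) (delta_mx 0 i) = 0.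
  have := LD (delta_mx 0 i + delta_mx 0 j).
  rewrite ND ZD addrA (addrACA (N _)) !e1 !add0r; apply.
  by move=> j'; rewrite mxE; have := e_range i j'; have := e_range j j'; lra.
have dbl0 : forall x : W, x + x = 0 -> x = 0.
  move=> x xx; have : 2%:R *: x = 0 :> W by rewrite scaler_nat mulr2n.
  by move/eqP; rewrite scaler_eq0 pnatr_eq0 => /eqP.
have Zd i : Z (delta_mx 0 i) (delta_mx 0 i) = 0 by exact: dbl0 (e2 i i).
have Ne i : N (delta_mx 0 i) = 0 by have := e1 i; rewrite Zd addr0.
have Lz a : L (base_mk 0 0 (delta_mx 0 a)) = 0.
  have prI b : (b == a) = ((pr b).1 == (pr a).1) && ((pr b).2 == (pr a).2).
    by rewrite -xpair_eqE -!surjective_pairing /pr (inj_eq val_inj) (inj_eq enum_val_inj).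
  have [d|d] := eqVneq (pr a).1 (pr a).2.
    rewrite -[RHS](Zd (pr a).1); congr (L (_, _, _)); apply/rowP => b.
    rewrite !mxE /= quad_systemII !mxE /= prI -d.
    by case: (_ == _); case: (_ == _); rewrite ?mulr0 ?mulr1.
  rewrite -[RHS](e2 (pr a).1 (pr a).2) -linearD; congr (L (_, _, _)); rewrite /= ?addr0//.
  apply/rowP => b; rewrite !mxE /= !quad_systemII !mxE /= prI.
  (* Only ordered pairs index the z-variables, so for distinct entries the reversed pair is absent
     and the quadratic row of e_j, e_i contributes nothing. *)
  have bn : ~~ (((pr b).1 == (pr a).2) && ((pr b).2 == (pr a).1)).
    apply/negP => /andP[/eqP b1 /eqP b2]; case/negP: d; apply/eqP/val_inj/eqP.
    rewrite eqn_leq (valP (enum_val a)) /= -/(pr a) -b1 -b2; exact: (valP (enum_val b)).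
  move: bn; do 4 case: (_ == _) => //=; rewrite ?mulr0 ?mulr1 ?addr0 ?add0r //.
have Lz0 z : L (base_mk 0 0 z) = 0.
  rewrite [base_mk 0 0 z]base_decomp !(linearD L) !(linear_sum L) linearZ_LR scale0r add0r.
  rewrite !big1 ?addr0// => [a _|i _]; rewrite linearZ_LR; first by rewrite [L _]Lz scaler0.
  by rewrite /by_ mxE scale0r.
have split_z x p z : base_mk x p z = base_mk x p 0 + base_mk 0 0 z.
  by congr (_, _, _); rewrite /= ?addr0 ?add0r.
have Ly0 i : L (base_vy (S := S) i) = 0.
  by have := Ne i; rewrite /N split_z linearD Lz0 addr0.
have Ly u : L (base_mk 0 u 0) = 0.
  rewrite [base_mk 0 u 0]base_decomp !(linearD L) !(linear_sum L) linearZ_LR scale0r add0r.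
  rewrite !big1 ?addr0// => [a _|i _]; rewrite linearZ_LR; first by rewrite [L _]Lz scaler0.
  by rewrite Ly0 scaler0.
have Lx : L base_vx = 0.
  move: L0; rewrite -[cone (S := S) p0]/(base_mk _ _ _) split_z linearD Lz0 addr0.
  have -> : base_mk 1 p0 0 = base_vx + base_mk 0 p0 0.
    by congr (_, _, _); rewrite /= ?addr0 ?add0r.
  by rewrite linearD Ly addr0.
move=> w; rewrite [w]base_decomp !(linearD L) !(linear_sum L) linearZ_LR Lx scaler0 add0r.
rewrite !big1 ?addr0// => [a _|i _]; rewrite linearZ_LR; first by rewrite [L _]Lz scaler0.
by rewrite Ly0 scaler0.
Qed.

(** A polynomial of degree at most two with three distinct roots is zero, by divided differences.
    The factor -2 matches the shape of [psi] at a pair (i, i). *)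
Lemma quadratic3_eq0 (c0 c1 c2 x y z : R) : x != y -> y != z -> x != z ->
  c0 - 2 * x * c1 + x ^+ 2 * c2 = 0 -> c0 - 2 * y * c1 + y ^+ 2 * c2 = 0 ->
  c0 - 2 * z * c1 + z ^+ 2 * c2 = 0 -> [/\ c0 = 0, c1 = 0 & c2 = 0].
Proof.
move=> xy yz xz Ex Ey Ez.
have Exy : (x + y) * c2 = 2 * c1.
  have /mulfI : x - y != 0 by rewrite subr_eq0.
  apply; apply/eqP; rewrite -subr_eq0; apply/eqP.
  by rewrite -[RHS](subrr 0) -{1}Ex -Ey; ring.
have Eyz : (y + z) * c2 = 2 * c1.
  have /mulfI : y - z != 0 by rewrite subr_eq0.
  apply; apply/eqP; rewrite -subr_eq0; apply/eqP.
  by rewrite -[RHS](subrr 0) -{1}Ey -Ez; ring.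
have c20 : c2 = 0.
  have /mulfI : x - z != 0 by rewrite subr_eq0.
  apply; rewrite mulr0 (_ : _ * _ = (x + y) * c2 - (y + z) * c2); last by ring.
  by rewrite Exy Eyz subrr.
have c10 : c1 = 0 by move: Exy; rewrite c20 mulr0; lra.
by split=> //; move: Ex; rewrite c10 c20 !mulr0 subr0 addr0.
Qed.

(** The components at the pairs (i, i) are quadratic in p_i with three distinct roots, so the x- and
    y-parts of [w] vanish; any one tangency condition then reduces to vanishing of the z-part. *)
Lemma psi3_systemII (p1 p2 p3 : 'rV[R]_(l - 1)) w : (1 < l)%N ->
  (forall i, p1 0 i != p2 0 i) -> (forall i, p2 0 i != p3 0 i) ->
  (forall i, p1 0 i != p3 0 i) ->
  (forall a, @psi R S a p1 w = 0) -> (forall a, @psi R S a p2 w = 0) ->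
  (forall a, @psi R S a p3 w = 0) -> w = 0.
Proof.
move=> l1 n12 n23 n13 h1 h2 h3.
have D i : by_ (S := S) i w = 0 /\ bx w = 0.
  pose ii : ordered_pair (l - 1) := exist _ (i, i) (leqnn i).
  pose a : 'I_#|ordered_pair (l - 1)| := enum_rank ii.
  have pra : pr a = (i, i) by rewrite /pr /a enum_rankK.
  pose y := by_ (S := S) i w.
  have E p : @psi R S a p w = bz (S := S) a w - 2 * p 0 i * y + p 0 i ^+ 2 * bx w.
    by rewrite /psi !quad_systemII pra /y /by_ /=; ring.
  have [|||_ y0 x0] := quadratic3_eq0 (c0 := bz (S := S) a w) (c1 := y) (c2 := bx w)
    (n12 i) (n23 i) (n13 i); by rewrite -?E.
have i0 : 'I_(l - 1) by exists 0; rewrite subn_gt0.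
have x0 : bx w = 0 by case: (D i0).
have y0 i : w.1.2 0 i = 0 by case: (D i).
apply: base_ext => // [i|a]; first by rewrite /by_ y0 mxE.
have := h1 a; rewrite /psi !quad_systemII x0 !y0 !(mulr0, mul0r, addr0, subr0) => ->.
by rewrite /bz mxE.
Qed.

Lemma rigid_systemII : (1 < l)%N -> rigid S.
Proof.
move=> l1 T [s12 s23 lT] psiT.
pose L u v : {linear base_space S -> base_space S} :=
  HB.pack (T u v) (GRing.isLinear.Build _ _ _ _ (T u v) (lT u v)).
(* The boxes [0, 2], [3, 5], [6, 8] are disjoint, so the coordinates of the three points differ. By
   symmetry of [T], its value is tangent to the cone at all three points. *)
have c0 p1 p2 p3 : (forall i, 0 <= p1 0 i <= 0 + 2) -> (forall i, 3 <= p2 0 i <= 3 + 2) ->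
    (forall i, 6 <= p3 0 i <= 6 + 2) ->
    T (cone (S := S) p1) (cone (S := S) p2) (cone (S := S) p3) = 0.
  move=> r1 r2 r3; apply: (psi3_systemII l1 (p1 := p1) (p2 := p2) (p3 := p3)).
  - by move=> i; apply/eqP => e; have := r1 i; have := r2 i; rewrite e; lra.
  - by move=> i; apply/eqP => e; have := r2 i; have := r3 i; rewrite e; lra.
  - by move=> i; apply/eqP => e; have := r1 i; have := r3 i; rewrite e; lra.
  - by move=> a; rewrite s12 s23.
  - by move=> a; rewrite s23.
  - by [].
(* The spanning lemma now frees one argument at a time. *)
have c1 p1 p2 w : (forall i, 0 <= p1 0 i <= 0 + 2) -> (forall i, 3 <= p2 0 i <= 3 + 2) ->
    T (cone (S := S) p1) (cone (S := S) p2) w = 0.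
  move=> r1 r2.
  apply: (cone_systemII_span (L := L (cone (S := S) p1) (cone (S := S) p2)) (s := 6)) => p3.
  exact: c0.
have c2 p1 v w : (forall i, 0 <= p1 0 i <= 0 + 2) -> T (cone (S := S) p1) v w = 0.
  move=> r1; rewrite s23; apply: (cone_systemII_span (L := L (cone (S := S) p1) w) (s := 3)).
  by move=> p2 r2; rewrite /= s23; exact: c1.
move=> u v w; rewrite s12 s23; apply: (cone_systemII_span (L := L v w) (s := 0)).
by move=> p1 r1; rewrite /= s23 s12; exact: c2.
Qed.

End SystemII.

(** * Systems III and IV: the null cone of a quadratic form *)

Section SystemKappa.
Context {R : realType} (n : nat) (kappa : 'M[R]_n).
Hypotheses (n0 : (0 < n)%N) (kappa_sym : kappa^T = kappa) (kappa_unit : kappa \in unitmx).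
Local Notation S := (system_kappa kappa).
Implicit Types (w : base_space S) (p : 'rV[R]_n).

Definition kappa_form (p r : 'rV[R]_n) : R := (p *m kappa *m r^T) 0 0.

Lemma quad_system_kappa (p r : 'rV[R]_n) : @quad R S ord0 p r = 2^-1 * kappa_form p r.
Proof.
rewrite /quad /kappa_form /= mxE mulr_sumr exchange_big; apply: eq_bigr => j _ /=.
rewrite !mxE !mulr_suml mulr_sumr; apply: eq_bigr => i _.
by rewrite mxE; ring.
Qed.

Lemma kappa_formC p r : kappa_form p r = kappa_form r p.
Proof.
rewrite /kappa_form (_ : p *m kappa *m r^T = (r *m kappa *m p^T)^T) ?mxE//.
by rewrite !trmx_mul trmxK kappa_sym mulmxA.
Qed.

Lemma kappa_form_nondeg p : (forall r, kappa_form p r = 0) -> p = 0.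
Proof.
move=> H; suff E : p *m kappa = 0 by rewrite -[p](mulmxK kappa_unit) E mul0mx.
apply/rowP => j.
by rewrite [RHS]mxE -(H (delta_mx 0 j)) /kappa_form trmx_delta -colE [RHS]mxE.
Qed.

Lemma kappa_formDl p q r : kappa_form (p + q) r = kappa_form p r + kappa_form q r.
Proof. by rewrite /kappa_form !mulmxDl mxE. Qed.

Lemma kappa_formDr p q r : kappa_form r (p + q) = kappa_form r p + kappa_form r q.
Proof. by rewrite !(kappa_formC r) kappa_formDl. Qed.

Lemma kappa_formZl c p r : kappa_form (c *: p) r = c * kappa_form p r.
Proof. by rewrite /kappa_form -!scalemxAl mxE. Qed.

Lemma kappa_formZr c p r : kappa_form r (c *: p) = c * kappa_form r p.
Proof. by rewrite !(kappa_formC r) kappa_formZl. Qed.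

(** Otherwise polarization would make the form zero, against non-degeneracy in positive
    dimension. *)
Lemma kappa_form_neq0 : exists p, kappa_form p p != 0.
Proof.
apply: contrapT => H.
have K0 p : kappa_form p p = 0.
  by apply/eqP; apply: contrapT => /negP Hp; apply: H; exists p.
have : (delta_mx 0 (Ordinal n0) : 'rV[R]_n) = 0.
  apply: kappa_form_nondeg => r; have := K0 (delta_mx 0 (Ordinal n0) + r).
  by rewrite kappa_formDl !kappa_formDr !K0 (kappa_formC r); lra.
by move/rowP/(_ (Ordinal n0)); rewrite !mxE !eqxx; apply/eqP; rewrite oner_eq0.
Qed.

(** The polarization of 2xz - kappa(y, y), which vanishes on the cone. *)
Definition conf_form (v w : base_space S) : R :=
  bx v * bz (S := S) ord0 w + bz (S := S) ord0 v * bx w - kappa_form v.1.2 w.1.2.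

Lemma conf_formC v w : conf_form v w = conf_form w v.
Proof. by rewrite /conf_form kappa_formC; ring. Qed.

Lemma conf_formDl v v' w : conf_form (v + v') w = conf_form v w + conf_form v' w.
Proof.
rewrite /conf_form !(linearD bx) !(linearD (bz (S := S) ord0)) kappa_formDl /=.
by ring.
Qed.

Lemma conf_formDr v v' w : conf_form w (v + v') = conf_form w v + conf_form w v'.
Proof. by rewrite !(conf_formC w) conf_formDl. Qed.

Lemma conf_form_nondeg w : (forall v, conf_form w v = 0) -> w = 0.
Proof.
move=> H; apply: base_ext => [|i|a].
- have := H (0, 0, const_mx 1).
  by rewrite /conf_form /bx /bz /= /kappa_form trmx0 mulmx0 !mxE mulr1 mulr0 addr0 subr0.
- rewrite /by_ [w.1.2]kappa_form_nondeg// => r.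
  have := H (0, r, 0); rewrite /conf_form /bx /bz /= !mxE !mulr0 addr0 sub0r.
  by move/eqP; rewrite oppr_eq0 => /eqP.
- rewrite [a]ord1; have := H (1, 0, 0).
  by rewrite /conf_form /bx /bz /= /kappa_form trmx0 mulmx0 !mxE mulr1 mulr0 add0r subr0.
Qed.

Lemma poly4_eq0 (c0 c1 c2 c3 c4 : R) :
  (forall t, c0 + t * c1 + t ^+ 2 * c2 + t ^+ 3 * c3 + t ^+ 4 * c4 = 0) ->
  [/\ c0 = 0, c1 = 0, c2 = 0, c3 = 0 & c4 = 0].
Proof.
move=> H; have := (H 0, H 1, H (-1), H 2, H (-2)); rewrite !expr0n /=.
by move=> [[[[h0 h1] h2] h3] h4]; split; lra.
Qed.

Lemma cone_kappa t p : @cone R S (t *: p) =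
  base_vx + t *: ((0, p, 0) : base_space S)
  + (t ^+ 2 * (2^-1 * kappa_form p p)) *: base_vz (S := S) ord0.
Proof.
apply: base_ext => [|i|a].
- by rewrite /bx /= !scaler0 !addr0.
- by rewrite /by_ /= !scaler0 add0r addr0.
- rewrite [a]ord1 /bz /= !mxE quad_system_kappa kappa_formZl kappa_formZr eqxx /=.
  by ring.
Qed.

Lemma psi_kappa t p w : @psi R S ord0 (t *: p) w =
  bz (S := S) ord0 w - t * kappa_form p w.1.2 + t ^+ 2 * (2^-1 * kappa_form p p) * bx w.
Proof.
rewrite /psi !quad_system_kappa (kappa_formC w.1.2) !kappa_formZl kappa_formZr.
by field.
Qed.

(** A linear map tangent to the null cone is an infinitesimal conformal map: tangency at the points
    [cone (t *: p)] is a quartic identity in [t], and its coefficients determine the needed entries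
    of [L]. *)
Lemma conf_form_rel (L : {linear base_space S -> base_space S}) :
  (forall p, @psi R S ord0 p (L (@cone R S p)) = 0) ->
  exists s, forall w, conf_form w (L w) = s * conf_form w w.
Proof.
move=> H.
pose ex : base_space S := base_vx; pose ez : base_space S := base_vz (S := S) ord0.
pose y p : base_space S := (0, p, 0).
pose f p := 2^-1 * kappa_form p p.
have E p : [/\ bz (S := S) ord0 (L ex) = 0,
   bz (S := S) ord0 (L (y p)) - kappa_form p (L ex).1.2 = 0,
   f p * bz (S := S) ord0 (L ez) - kappa_form p (L (y p)).1.2 + f p * bx (L ex) = 0,
   - (f p * kappa_form p (L ez).1.2) + f p * bx (L (y p)) = 0
  & f p ^+ 2 * bx (L ez) = 0].
  apply: poly4_eq0 => t; rewrite -[RHS](H (t *: p)) psi_kappa cone_kappa.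
  rewrite -/ex -/ez -/(y p) -/(f p) !(linearD L) !(linearZ_LR L).
  rewrite !(linearD bx) !(linearD (bz (S := S) ord0))
    !(linearZ_LR bx) !(linearZ_LR (bz (S := S) ord0)) /=.
  rewrite !kappa_formDr !kappa_formZr /GRing.scale /=.
  by ring.
have [p0 p0n] := kappa_form_neq0.
have zx : bx (L ez) = 0.
  have [_ _ _ _ /eqP] := E p0.
  by rewrite mulf_eq0 expf_eq0 /= /f mulf_eq0 invr_eq0 pnatr_eq0 (negbTE p0n) => /eqP.
(* The equation is known up to the factor [f p]. For isotropic [p] it is recovered by moving along
   the non-isotropic [p0]: [m] is constant on that line, and the coefficient of t^2 is non-zero. *)
have yx p : bx (L (y p)) = kappa_form p (L ez).1.2.
  pose m p := bx (L (y p)) - kappa_form p (L ez).1.2.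
  have mE p' : f p' * m p' = 0 by have [_ _ _ + _] := E p'; rewrite /m; lra.
  have yD p' q t : y (p' + t *: q) = y p' + t *: y q.
    by congr (_, _, _); rewrite /= ?scaler0 ?addr0.
  have mD p' q t : m (p' + t *: q) = m p' + t * m q.
    rewrite /m yD linearD (linearZ_LR L) (linearD bx) (linearZ_LR bx).
    rewrite kappa_formDl kappa_formZl /GRing.scale /=.
    by ring.
  have m0 : m p0 = 0.
    have /eqP := mE p0.
    by rewrite mulf_eq0 /f mulf_eq0 invr_eq0 pnatr_eq0 (negbTE p0n) => /eqP.
  suff : m p = 0 by rewrite /m; lra.
  have F t : (kappa_form p p + 2 * t * kappa_form p p0 + t ^+ 2 * kappa_form p0 p0) * m p = 0.
    have := mE (p + t *: p0); rewrite mD m0 mulr0 addr0 /f => e.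
    rewrite -[RHS](mulr0 2) -e kappa_formDl !kappa_formDr !kappa_formZl !kappa_formZr.
    rewrite (kappa_formC p0 p).
    by field.
  have /eqP : kappa_form p0 p0 * m p = 0 by have := F 0; have := F 1; have := F (-1); lra.
  by rewrite mulf_eq0 (negbTE p0n) => /eqP.
(* This value is forced by the vector [ex + ez], on which the form is 2. *)
exists (2^-1 * (bz (S := S) ord0 (L ez) + bx (L ex))) => w.
have wE : w = bx w *: ex + y w.1.2 + bz (S := S) ord0 w *: ez.
  apply: base_ext => [|i|a].
  - by rewrite /bx /= scaler0 !addr0 [RHS]mulr1.
  - by rewrite /by_ /= !scaler0 add0r addr0.
  - by rewrite [a]ord1 /bz /= scaler0 !addr0 add0r !mxE eqxx mulr1.
have [e1 e2 e3 _ _] := E w.1.2.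
rewrite /conf_form [in L w]wE !(linearD L) !(linearZ_LR L).
rewrite !(linearD bx) !(linearD (bz (S := S) ord0))
    !(linearZ_LR bx) !(linearZ_LR (bz (S := S) ord0)) /=.
rewrite !kappa_formDr !kappa_formZr e1 zx yx /GRing.scale /=.
have -> : bz (S := S) ord0 (L (y w.1.2)) = kappa_form w.1.2 (L ex).1.2 by lra.
have -> : kappa_form w.1.2 (L (y w.1.2)).1.2
  = f w.1.2 * (bz (S := S) ord0 (L ez) + bx (L ex)) by lra.
by rewrite /f; field.
Qed.

(** Each T(u, v, .) is conformal with a factor s(u, v). Symmetry of [T] forces all factors to
    vanish, so each T(u, v, .) is skew for [conf_form]. *)
Lemma rigid_system_kappa : rigid S.
Proof.
move=> T [s12 s23 lT] psiT.
pose L u v : {linear base_space S -> base_space S} :=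
  HB.pack (T u v) (GRing.isLinear.Build _ _ _ _ (T u v) (lT u v)).
have s13 (u v w : base_space S) : T u v w = T w v u by rewrite s12 s23 s12.
have TD (u v w w' : base_space S) : T u v (w + w') = T u v w + T u v w'.
  exact: (linearD (L u v)).
have TZ (u v w : base_space S) c : T u v (c *: w) = c *: T u v w.
  exact: (linearZ_LR (L u v)).
have [s sE] : exists s : base_space S -> base_space S -> R, forall u v w,
    conf_form w (T u v w) = s u v * conf_form w w.
  have H (uv : base_space S * base_space S) : exists s,
      forall w, conf_form w (T uv.1 uv.2 w) = s * conf_form w w.
    by apply: (conf_form_rel (L := L uv.1 uv.2)) => p; exact: psiT.
  have [s Hs] := choice H.
  by exists (fun u v => s (u, v)) => u v w; exact: (Hs (u, v)).
have pol (u v w x : base_space S) :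
    conf_form x (T u v w) + conf_form w (T u v x) = 2 * s u v * conf_form w x.
  have := sE u v (w + x); rewrite TD !conf_formDl !conf_formDr !sE (conf_formC x w).
  lra.
have [p0 p0n] := kappa_form_neq0.
pose w0 : base_space S := (0, p0, 0).
have w0n : conf_form w0 w0 != 0.
  by rewrite /conf_form /bx /bz /= !mul0r mulr0 addr0 sub0r oppr_eq0.
(* The factors were merely chosen; their symmetry and bilinearity are recovered by evaluating at the
   non-isotropic [w0]. *)
have sC (u v : base_space S) : s u v = s v u by apply: (mulIf w0n); rewrite -!sE s12.
have sD (u v v' : base_space S) : s u (v + v') = s u v + s u v'.
  by apply: (mulIf w0n); rewrite mulrDl -!sE s23 TD conf_formDr !(s23 u w0).
have sDl (u v v' : base_space S) : s (v + v') u = s v u + s v' u.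
  by rewrite !(sC _ u) sD.
have sZ (u v : base_space S) c : s u (c *: v) = c * s u v.
  apply: (mulIf w0n); rewrite -mulrA -!sE s23 TZ (s23 u w0).
  rewrite /conf_form (linearZ_LR bx) (linearZ_LR (bz (S := S) ord0)) kappa_formZr.
  rewrite /GRing.scale /=.
  by ring.
have sZl (u v : base_space S) c : s (c *: v) u = c * s v u.
  by rewrite !(sC _ u) sZ.
(* Polarized conformality of T(v, w, .) at the pair (w, v), rewritten by symmetry of [T]. *)
have key (v w : base_space S) :
    s v v * conf_form w w + s w w * conf_form v v = 2 * s v w * conf_form v w.
  by rewrite -!sE (conf_formC v w) -(pol v w w v) (s23 v w v) (s13 v w w) addrC.
pose ex : base_space S := base_vx; pose ez : base_space S := base_vz (S := S) ord0.
pose y p : base_space S := (0, p, 0).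
have k0r p : kappa_form p 0 = 0 by rewrite -(scale0r p) kappa_formZr mul0r.
have k0l p : kappa_form 0 p = 0 by rewrite kappa_formC.
have Qxx : conf_form ex ex = 0 by rewrite /conf_form /bx /bz /= !mxE k0r; ring.
have Qzz : conf_form ez ez = 0 by rewrite /conf_form /bx /bz /= !mxE k0r; ring.
have Qxz : conf_form ex ez = 1 by rewrite /conf_form /bx /bz /= !mxE k0r !eqxx /=; ring.
have Qxy p : conf_form ex (y p) = 0 by rewrite /conf_form /bx /bz /= !mxE k0l; ring.
have Qyz p : conf_form (y p) ez = 0 by rewrite /conf_form /bx /bz /= !mxE k0r; ring.
(* In each use of [key] below, the known products and the values of [s] already found isolate one
   unknown. *)
have sxz : s ex ez = 0 by have := key ex ez; rewrite Qxx Qzz Qxz; lra.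
have sxx : s ex ex = 0.
  apply: (mulIf w0n); have := key ex (y p0); rewrite Qxx Qxy -/w0; lra.
have szz : s ez ez = 0.
  apply: (mulIf w0n); have := key (y p0) ez; rewrite Qzz Qyz -/w0; lra.
have syy p : s (y p) (y p) = 0.
  have := key (ex + ez) (y p).
  rewrite !conf_formDl !conf_formDr !sDl !sD (conf_formC ez) (conf_formC ez).
  rewrite Qxx Qzz Qxz Qxy Qyz.
  rewrite (sC ez) sxx szz sxz; lra.
have syz p : s (y p) ez = 0.
  have := key (ex + y p) ez.
  rewrite !conf_formDl !conf_formDr !sDl !sD Qzz Qxz Qyz szz sxz; lra.
have sxy p : s ex (y p) = 0.
  have := key ex (y p + ez).
  rewrite !conf_formDl !conf_formDr !sDl !sD Qxx Qxz Qxy sxx sxz; lra.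
have sww (w : base_space S) : s w w = 0.
  have -> : w = bx w *: ex + y w.1.2 + bz (S := S) ord0 w *: ez.
    apply: base_ext => [|i|a].
    - by rewrite /bx /= scaler0 !addr0 [RHS]mulr1.
    - by rewrite /by_ /= !scaler0 add0r addr0.
    - by rewrite [a]ord1 /bz /= scaler0 !addr0 add0r !mxE eqxx mulr1.
  rewrite !sDl !sD !sZl !sZ (sC ez ex) (sC (y _) ex) (sC ez (y _)).
  by rewrite sxx syy szz sxz sxy syz; ring.
have s0 (u v : base_space S) : s u v = 0.
  by have := sww (u + v); rewrite sDl !sD !sww (sC v u); lra.
have anti (u v w x : base_space S) : conf_form x (T u v w) = - conf_form w (T u v x).
  by have := pol u v w x; rewrite s0; lra.
(* conf_form x (T u v w) is symmetric in u, v, w and skew in w, x, hence zero. *)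
move=> u v w; apply: conf_form_nondeg => x; rewrite conf_formC.
have := anti u v w x.
rewrite (s23 u v x) (anti u x v w) (s23 u x w) (anti u w x v) (s23 u w v).
by lra.
Qed.

End SystemKappa.

(** * Contact forms on the jet space and their Lie derivatives *)

Section Jet.
Context {R : realType} {S : quad_system R}.
Implicit Types (q v : jet_space S) (i : 'I_(qs_ny S)) (a : 'I_(qs_nz S)).

Definition lift_base (b : base_space S) : jet_space S := (b, 0).
Definition vertical (u : 'rV[R]_(qs_ny S)) : jet_space S := (0, u).
Definition jet_base q : base_space S := q.1.

Fact lift_base_linear : linear lift_base.
Proof. by move=> c b b'; congr (_, _); rewrite /= scaler0 addr0. Qed.
HB.instance Definition _ :=
  GRing.isLinear.Build R (base_space S) (jet_space S) *:%R lift_base lift_base_linear.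
Fact vertical_linear : linear vertical.
Proof. by move=> c b b'; congr (_, _); rewrite /= scaler0 addr0. Qed.
HB.instance Definition _ :=
  GRing.isLinear.Build R _ (jet_space S) *:%R vertical vertical_linear.
Fact jet_base_linear : linear jet_base. Proof. by []. Qed.
HB.instance Definition _ :=
  GRing.isLinear.Build R (jet_space S) (base_space S) *:%R jet_base jet_base_linear.
Fact cp_linear i : linear (cp i). Proof. by move=> c v w; rewrite /cp /= !mxE. Qed.
HB.instance Definition _ i :=
  GRing.isLinear.Build R (jet_space S) R *%R (cp i) (cp_linear i).

Lemma continuous_lift_base : continuous lift_base.
Proof.
move=> b; apply: differentiable_continuous.
by apply: (@differentiable_pair _ _ _ _ id (cst 0)).
Qed.

Lemma continuous_jet_base : continuous jet_base.
Proof. by move=> q; exact: cvg_fst. Qed.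

Lemma continuous_cp i : continuous (cp i).
Proof.
move=> q; rewrite /cp.
apply: (@continuous_comp _ _ _ snd (fun M : 'rV[R]_(qs_ny S) => M 0 i)).
  exact: cvg_snd.
exact: coord_continuous.
Qed.

Lemma Frhs_quad a q : Frhs a q = quad a q.2 q.2.
Proof. by []. Qed.

Lemma is_derive_Frhs a q v : is_derive q v (Frhs a) (quad a v.2 q.2 + quad a q.2 v.2).
Proof.
have dcp i := derive_lin q v (@continuous_cp i).
have -> : Frhs a = \sum_i (\sum_j ((cst (qs_F a i j) * cp i) * cp j)).
  by apply/funext => x; rewrite fct_sumE; apply: eq_bigr => i _; rewrite fct_sumE.
have -> : quad a v.2 q.2 + quad a q.2 v.2 =
    \sum_i \sum_j (qs_F a i j * cp i v * cp j q + qs_F a i j * cp i q * cp j v).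
  rewrite /quad -big_split; apply: eq_bigr => i _ /=.
  by rewrite -big_split.
apply: is_derive_sum => i; apply: is_derive_sum => j; apply: is_derive_eq.
rewrite /GRing.scale /= mulr0 addr0 addrC; congr (_ + _).
by rewrite mulrC.
Qed.

Lemma jet_cone_decomp q :
  (cone q.2, 0) = vec_x + \sum_i cp i q *: vec_y i + \sum_a Frhs a q *: vec_z a :> jet_space S.
Proof.
have -> : (cone q.2, 0) = lift_base (cone q.2) by [].
have Ex : lift_base (bx (cone q.2) *: base_vx) = vec_x :> jet_space S.
  by rewrite linearZ_LR; exact: scale1r.
have Ey i : lift_base (by_ i (cone q.2) *: base_vy i) = cp i q *: vec_y i :> jet_space S.
  by rewrite linearZ_LR.
have Ez a : lift_base (bz a (cone q.2) *: base_vz a) = Frhs a q *: vec_z a :> jet_space S.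
  by rewrite linearZ_LR /bz /= mxE.
rewrite [cone q.2]base_decomp !(linearD lift_base) !(linear_sum lift_base) /= Ex.
by rewrite (eq_bigr _ (fun i _ => Ey i)) (eq_bigr _ (fun a _ => Ez a)).
Qed.

(** The operator D_x is differentiation along the cone vector with zero fibre part;
    differentiability makes the derivative linear in the direction. *)
Lemma Dx_cone (f : jet_space S -> R) q : differentiable f q ->
  Dx f q = 'D_((cone q.2, 0) : jet_space S) f q.
Proof.
move=> df; rewrite jet_cone_decomp /Dx !deriveE// !linearD !linear_sum.
congr (_ + _ + _); apply: eq_bigr => i _; rewrite linearZ_LR deriveE//.
Qed.

Lemma contact_y_pfaffian i : in_pfaffian (@contact_y R S i).
Proof.
exists (fun j _ => (j == i)%:R), (fun _ _ => 0); split.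
- by move=> j; exact: smooth_cst.
- by move=> a; exact: smooth_cst.
- move=> q v; rewrite [X in _ + X]big1 => [|a _]; last by rewrite mul0r.
  rewrite (bigD1 i)//= eqxx mul1r big1 ?addr0// => j /negbTE ->.
  by rewrite mul0r.
Qed.

Lemma contact_z_pfaffian a : in_pfaffian (@contact_z R S a).
Proof.
exists (fun _ _ => 0), (fun b _ => (b == a)%:R); split.
- by move=> i; exact: smooth_cst.
- by move=> b; exact: smooth_cst.
- move=> q v; rewrite big1 ?add0r => [|i _]; last by rewrite mul0r.
  rewrite (bigD1 a)//= eqxx mul1r big1 ?addr0// => b /negbTE ->.
  by rewrite mul0r.
Qed.

Section Symmetry.
Variable X : jet_space S -> jet_space S.
Hypothesis hX : infinitesimal_symmetry X.

(** The Lie derivative is again a combination of the contact forms, so it vanishes wherever they all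
    do. *)
Lemma symmetry_kernel (theta : one_form) q v : in_pfaffian theta ->
  (forall i, contact_y i q v = 0) -> (forall a, contact_z a q v = 0) ->
  lie_derivative X theta q v = 0.
Proof.
move=> tI y0 z0; case: hX => _ /(_ _ tI)[f [g [_ _ ->]]].
by rewrite !big1 ?addr0// => [a _|i _]; rewrite ?y0 ?z0 mulr0.
Qed.

Lemma symmetry_y i q v :
  (forall i, contact_y i q v = 0) -> (forall a, contact_z a q v = 0) ->
  cy i ('D_v X q) - cp i q * cx ('D_v X q) = cp i (X q) * cx v.
Proof.
move=> y0 z0; have := symmetry_kernel (contact_y_pfaffian i) y0 z0.
have dcp := derive_lin q (X q) (@continuous_cp i).
(* In the first term of the Lie derivative [v] is fixed, so only the factor [cp i] is
   differentiated, along [X q]. *)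
rewrite /lie_derivative (_ : 'D_(X q) _ q = - (cp i (X q) * cx v)).
  by move/eqP; rewrite addrC subr_eq0 => /eqP.
have H : is_derive q (X q) (cst (cy i v) - cp i * cst (cx v)) (- (cp i (X q) * cx v)).
  by apply: is_derive_eq; rewrite scaler0 !add0r /GRing.scale /= mulrC.
exact: derive_val.
Qed.

Lemma symmetry_z a q v :
  (forall i, contact_y i q v = 0) -> (forall a, contact_z a q v = 0) ->
  cz a ('D_v X q) - Frhs a q * cx ('D_v X q)
  = (quad a (X q).2 q.2 + quad a q.2 (X q).2) * cx v.
Proof.
move=> y0 z0; have := symmetry_kernel (contact_z_pfaffian a) y0 z0.
have dF := is_derive_Frhs a q (X q).
rewrite /lie_derivative.
rewrite (_ : 'D_(X q) _ q = - ((quad a (X q).2 q.2 + quad a q.2 (X q).2) * cx v)).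
  by move/eqP; rewrite addrC subr_eq0 => /eqP.
have H : is_derive q (X q) (cst (cz a v) - Frhs a * cst (cx v))
    (- ((quad a (X q).2 q.2 + quad a q.2 (X q).2) * cx v)).
  by apply: is_derive_eq; rewrite scaler0 !add0r /GRing.scale /= mulrC.
exact: derive_val.
Qed.

End Symmetry.
End Jet.

(** * A symmetry descends to the (x, y, z)-space and is the prolongation of the field obtained
    there *)

Section Symmetry.
Context {R : realType} {S : quad_system R}.
Implicit Types (q v : jet_space S) (i : 'I_(qs_ny S)) (a : 'I_(qs_nz S)).
Variable X : jet_space S -> jet_space S.
Hypothesis hX : infinitesimal_symmetry X.
Hypothesis ny_gt1 : (1 < qs_ny S)%N.

Let sX : smooth X. Proof. by case: hX. Qed.

Lemma smooth_base_coeff (l : {linear base_space S -> R}) : continuous l ->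
  smooth (fun q => l (X q).1).
Proof.
move=> cl; have sB : smooth (jet_base \o X).
  by apply: (smooth_comp_lin (l := jet_base) (j := idfun) continuous_jet_base _ sX) => x.
by apply: (smooth_comp_lin (j := idfun) cl _ sB) => x.
Qed.

Lemma derive_base_coeff (l : {linear base_space S -> R}) q v : continuous l ->
  'D_v (fun q => l (X q).1) q = l ('D_v X q).1.
Proof.
move=> cl; have dX : derivable X q v by exact: smooth_derivable.
have dB := derive_comp_lin continuous_jet_base dX.
have dB' : derivable (jet_base \o X) q v by exact: ex_derive.
have /@derive_val -> := derive_comp_lin cl dB'.
by have /@derive_val -> := dB.
Qed.

Let A q := cx (X q).
Let B i q := cy i (X q).
Let C a q := cz a (X q).

Let sA : smooth A. Proof. exact: (smooth_base_coeff continuous_bx). Qed.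
Let sB i : smooth (B i). Proof. exact: (smooth_base_coeff (@continuous_by _ _ i)). Qed.
Let sC a : smooth (C a). Proof. exact: (smooth_base_coeff (@continuous_bz _ _ a)). Qed.
Let DA q v : 'D_v A q = cx ('D_v X q).
Proof. exact: (derive_base_coeff q v continuous_bx). Qed.
Let DB i q v : 'D_v (B i) q = cy i ('D_v X q).
Proof. exact: (derive_base_coeff q v (@continuous_by _ _ i)). Qed.
Let DC a q v : 'D_v (C a) q = cz a ('D_v X q).
Proof. exact: (derive_base_coeff q v (@continuous_bz _ _ a)). Qed.

Lemma contact_cone q : (forall i, contact_y i q (cone q.2, 0) = 0) /\
  (forall a, contact_z a q (cone q.2, 0) = 0).
Proof.
split=> [i|a]; rewrite /contact_y /contact_z /cy /cz /cx /= mulr1 ?mxE /cp ?subrr//.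
Qed.

Lemma contact_vertical q u : (forall i, contact_y i q (vertical u) = 0) /\
  (forall a, contact_z a q (vertical u) = 0).
Proof.
by split=> [i|a]; rewrite /contact_y /contact_z /cy /cz /cx /= mulr0 ?mxE subr0.
Qed.

Lemma symmetry_prolongation i q : cp i (X q) = Dx (B i) q - cp i q * Dx A q.
Proof.
have [y0 z0] := contact_cone q.
rewrite !Dx_cone; [|exact: smooth_diff..].
by rewrite DA DB (symmetry_y hX i y0 z0) [cx _]/= mulr1.
Qed.

Lemma derive_vertical_y i q u :
  'D_(vertical u) (B i) q = cp i q * 'D_(vertical u) A q.
Proof.
have [y0 z0] := contact_vertical q u; have := symmetry_y hX i y0 z0.
by rewrite DB DA [X in _ = _ * X](_ : _ = 0)// mulr0 => /eqP; rewrite subr_eq0 => /eqP.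
Qed.

Lemma derive_vertical_z a q u :
  'D_(vertical u) (C a) q = Frhs a q * 'D_(vertical u) A q.
Proof.
have [y0 z0] := contact_vertical q u; have := symmetry_z hX a y0 z0.
by rewrite DC DA [X in _ = _ * X](_ : _ = 0)// mulr0 => /eqP; rewrite subr_eq0 => /eqP.
Qed.

(* G = B_i - p_i A depends on the fibre coordinate p_i only, and A = - dG/dp_i. *)
Lemma coeff_x_shift i j q (t : R) : i != j ->
  A (q + t *: vertical (delta_mx 0 j)) = A q.
Proof.
move=> ij; pose G q := B i q - cp i q * A q.
have dcp q' v := derive_lin q' v (@continuous_cp R S i).
(* The derivative of B_i cancels p_i times that of A, by [derive_vertical_y]. *)
have dG q' u : is_derive q' (vertical u) G (- (u 0 i * A q')).
  have dA : is_derive q' (vertical u) A ('D_(vertical u) A q').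
    exact/derivableP/smooth_derivable.
  have dB : is_derive q' (vertical u) (B i) ('D_(vertical u) (B i) q').
    exact/derivableP/smooth_derivable.
  have -> : G = (B i - cp i * A) by [].
  apply: is_derive_eq; rewrite derive_vertical_y /GRing.scale /=.
  have -> : cp i (vertical u) = u 0 i by [].
  by move: ('D_(vertical u) A q') (A q') (cp i q') (u 0 i) => x y z w; ring.
have DG q' u : 'D_(vertical u) G q' = - (u 0 i * A q').
  by have /@derive_val := dG q' u.
have Gshift q' s : G (q' + s *: vertical (delta_mx 0 j)) = G q'.
  apply: derive0_shift => x; first by have [] := dG x (delta_mx 0 j).
  by rewrite DG mxE (negbTE ij) andbF mul0r oppr0.
have E : 'D_(vertical (delta_mx 0 i)) G (q + t *: vertical (delta_mx 0 j))
   = 'D_(vertical (delta_mx 0 i)) G q.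
  by apply: derive_invariant_shift => x; exact: Gshift.
move: E; rewrite !DG mxE !eqxx !mul1r => /eqP.
by rewrite eqr_opp => /eqP.
Qed.

Lemma other_index (j : 'I_(qs_ny S)) : exists i, i != j.
Proof.
have [j0|j0] := eqVneq (j : nat) 0%N.
  by exists (Ordinal ny_gt1); apply/eqP => /(congr1 val) /=; rewrite j0.
by exists (Ordinal (ltnW ny_gt1)); apply/eqP => /(congr1 val) /= e; rewrite -e in j0.
Qed.

(** For each fibre direction [j] another index [i] exists, so [coeff_x_shift] applies to every basis
    direction. *)
Lemma derive_vertical_x q u : 'D_(vertical u) A q = 0.
Proof.
have dA : differentiable A q by exact: smooth_diff.
rewrite deriveE// [u]row_sum_delta linear_sum linear_sum big1// => j _.
rewrite linearZ_LR linearZ_LR /= -deriveE// derive_invariant ?scaler0// => t.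
by have [i ij] := other_index j; exact: coeff_x_shift ij.
Qed.

Lemma base_part_vertical q u : (X (q + vertical u)).1 = (X q).1.
Proof.
have sh (f : jet_space S -> R) : smooth f -> (forall q, 'D_(vertical u) f q = 0) ->
    f (q + vertical u) = f q.
  move=> sf f0; rewrite -[vertical u]scale1r.
  by apply: derive0_shift => // x; exact: smooth_derivable.
apply: base_ext => [|i|a].
- by apply: (sh A) => // x; exact: derive_vertical_x.
- by apply: (sh (B i)) => // x; rewrite derive_vertical_y derive_vertical_x mulr0.
- by apply: (sh (C a)) => // x; rewrite derive_vertical_z derive_vertical_x mulr0.
Qed.

(** The field Y = (A, B, C) on the base, read off at fibre coordinate zero. *)
Definition base_field (b : base_space S) : base_space S := (X (lift_base b)).1.

Lemma base_fieldE q : (X q).1 = base_field q.1.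
Proof.
rewrite /base_field -(base_part_vertical (lift_base q.1) q.2); congr (X _).1.
by case: q => b p; congr (_, _); rewrite /= ?addr0 ?add0r.
Qed.

Lemma smooth_base_field : smooth base_field.
Proof.
exact: (smooth_comp_lin continuous_jet_base continuous_lift_base sX).
Qed.

Lemma derive_base_field q v : ('D_v X q).1 = 'D_(v.1) base_field q.1.
Proof.
have dX : derivable X q v by exact: smooth_derivable.
have /@derive_val E := derive_comp_lin continuous_jet_base dX.
rewrite -[LHS]E -[RHS](derive_precomp_lin jet_base base_field q v).
by congr ('D_v _ q); apply/funext => x; exact: base_fieldE.
Qed.

(** The y-equations on the D_x direction express the fibre part of [X] through the derivative of Y;
    substituted into the z-equations they give [psi]. The point (b, p) of the jet space is
    arbitrary, so [p] and [b] are independent. *)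
Lemma psi_derive_base_field a (p : 'rV[R]_(qs_ny S)) b :
  psi a p ('D_(cone p) base_field b) = 0.
Proof.
pose q : jet_space S := (b, p).
have [y0 z0] := contact_cone q.
have := symmetry_z hX a y0 z0.
have -> : 'D_(cone p) base_field b = ('D_((cone q.2, 0) : jet_space S) X q).1.
  by rewrite derive_base_field.
set w := 'D__ X q.
have c1 : cx ((cone q.2, 0) : jet_space S) = 1 by [].
have -> : (X q).2 = w.1.1.2 - bx w.1 *: p.
  apply/rowP => i; have := symmetry_y hX i y0 z0; rewrite -/w c1 mulr1 => Ei.
  by rewrite -[LHS]/(cp i (X q)) -Ei !mxE mulrC.
rewrite c1 mulr1 Frhs_quad -(scaleNr (bx w.1)) !quadDl !quadDr quadZl quadZr /psi.
rewrite -[cz a w]/(bz a w.1) -[cx w]/(bx w.1) -[q.2]/p => /eqP.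
rewrite -subr_eq0 => /eqP E; rewrite -[RHS]E.
by ring.
Qed.

End Symmetry.

(** * Closure properties of polynomial functions of degree at most two *)

Section QuadraticPolynomial.
Context {R : realType} {N : nat}.
Implicit Types (r : 'rV[R]_N) (k : 'I_N).

Definition quadratic_poly (g : 'rV[R]_N -> R) : Prop :=
  exists P : mpoly N R, (msize P <= 3)%N /\ forall r, g r = meval (fun k => r 0 k) P.

Lemma quadratic_poly_cst (c : R) : quadratic_poly (fun=> c).
Proof.
exists (mpolyC N c); split; last by move=> r; rewrite mevalC.
by rewrite mmeasureC; case: (_ != _).
Qed.

Lemma quadratic_polyD g h : quadratic_poly g -> quadratic_poly h ->
  quadratic_poly (fun r => g r + h r).
Proof.
move=> [P [sP gP]] [Q [sQ hQ]]; exists (P + Q); split.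
  by apply: leq_trans (mmeasureD_le _ _ _) _; rewrite geq_max sP sQ.
by move=> r; rewrite mevalD gP hQ.
Qed.

Lemma quadratic_polyZ c g : quadratic_poly g -> quadratic_poly (fun r => c * g r).
Proof.
move=> [P [sP gP]]; exists (c *: P); split; first exact: leq_trans (msizeZ_le _ _) _.
by move=> r; rewrite mevalZ gP.
Qed.

Lemma quadratic_poly_sum (I : Type) (s : seq I) (g : I -> 'rV[R]_N -> R) :
  (forall i, quadratic_poly (g i)) -> quadratic_poly (fun r => \sum_(i <- s) g i r).
Proof.
move=> gq; elim: s => [|i s IH].
  rewrite (_ : (fun r => _) = (fun=> 0)); first exact: quadratic_poly_cst.
  by apply/funext => r; rewrite big_nil.
rewrite (_ : (fun r => _) = (fun r => g i r + \sum_(j <- s) g j r)).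
  exact: quadratic_polyD.
by apply/funext => r; rewrite big_cons.
Qed.

Lemma quadratic_poly_coord k : quadratic_poly (fun r => r 0 k).
Proof.
exists (mpolyX R (mnm1 k)); split; last by move=> r; rewrite mevalXU.
by rewrite msizeX mdeg1.
Qed.

Lemma quadratic_poly_coord2 k k' : quadratic_poly (fun r => r 0 k * r 0 k').
Proof.
exists (mpolyX R (mnm1 k) * mpolyX R (mnm1 k')); split.
  by rewrite -mpolyXD msizeX mdegD !mdeg1.
by move=> r; rewrite mevalM !mevalXU.
Qed.

End QuadraticPolynomial.

(** * The third derivative of a field on the base *)

Section BaseField.
Context {R : realType} {S : quad_system R}.
Variable Y : base_space S -> base_space S.
Hypothesis sY : smooth Y.
Implicit Types (b u v w : base_space S).

(** Schwarz's theorem for real functions, applied to each coordinate of [Y]. *)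
Lemma base_field_derive_comm u v b :
  'D_u (fun x => 'D_v Y x) b = 'D_v (fun x => 'D_u Y x) b.
Proof.
have comm (l : {linear base_space S -> R}) : continuous l ->
    l ('D_u (fun x => 'D_v Y x) b) = l ('D_v (fun x => 'D_u Y x) b).
  move=> cl; have s1 w := smooth_derive w sY.
  have E w w' : 'D_w (l \o (fun x => 'D_w' Y x)) b = l ('D_w (fun x => 'D_w' Y x) b).
    exact: (congr1 (@^~ b) (derive_comp_lin_fun w cl (s1 w'))).
  apply: etrans (esym (E u v)) (etrans _ (E v u)).
  have F w := derive_comp_lin_fun w cl sY.
  apply: etrans (congr1 (fun g => 'D_u g b) (esym (F v))) _.
  apply: etrans _ (congr1 (fun g => 'D_v g b) (F u)).
  exact/derive_comm/smooth_lin_comp.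
apply: base_ext => [|i|a].
- exact: (comm bx continuous_bx).
- exact: (comm (by_ i) (@continuous_by _ _ i)).
- exact: (comm (bz a) (@continuous_bz _ _ a)).
Qed.
End BaseField.

Lemma derive3_sym_trilinear (R : realType) (S : quad_system R)
    (Y : base_space S -> base_space S) b :
  smooth Y ->
  sym_trilinear (fun u v w => 'D_u (fun x => 'D_v (fun x => 'D_w Y x) x) b).
Proof.
move=> sY.
split=> [u v w|u v w|u v c w w'].
- exact: (base_field_derive_comm (smooth_derive w sY)).
- apply: (congr1 (fun g => 'D_u g b)); apply/funext => x.
  exact: base_field_derive_comm.
- have E1 : (fun x => 'D_(c *: w + w') Y x) = (fun x => c *: 'D_w Y x + 'D_w' Y x).
    by apply/funext => x; rewrite deriveDv ?deriveZv//; exact: smooth_diff.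
  have E2 : (fun x => 'D_v (fun x => 'D_(c *: w + w') Y x) x)
      = (fun x => c *: 'D_v (fun x => 'D_w Y x) x + 'D_v (fun x => 'D_w' Y x) x).
    apply/funext => x; apply: etrans (congr1 (fun g => 'D_v g x) E1) _.
    exact: (derive_lincomb c x v (smooth_derive w sY) (smooth_derive w' sY)).
  apply: etrans (congr1 (fun g => 'D_u g b) E2) _.
  exact: (derive_lincomb c b u (smooth_derive v (smooth_derive w sY))
    (smooth_derive v (smooth_derive w' sY))).
Qed.

(** For fixed [p] the form [psi a p] is constant in [b], so the tangency identity can be
    differentiated twice; rigidity then applies to the third derivative. *)
Lemma rigid_derive3_eq0 (R : realType) (S : quad_system R)
    (Y : base_space S -> base_space S) :
  smooth Y -> rigid S ->
  (forall a p b, psi a p ('D_(cone p) Y b) = 0) ->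
  forall u v w b, 'D_u (fun x => 'D_v (fun x => 'D_w Y x) x) b = 0.
Proof.
move=> sY rS psiY u v w b.
apply: (rS _ (derive3_sym_trilinear b sY)) => {u v w}u v a p.
have cl := @continuous_psi R S a p.
have s1 := smooth_derive (cone p) sY.
have s2 := smooth_derive v s1.
have D0 : psi a p \o (fun x => 'D_(cone p) Y x) = cst 0.
  by apply/funext => x /=; exact: psiY.
have D1 : psi a p \o (fun x => 'D_v (fun x => 'D_(cone p) Y x) x) = cst 0.
  apply: etrans (esym (derive_comp_lin_fun v cl s1)) _.
  by rewrite D0; apply/funext => x; rewrite derive_cst.
apply: etrans (esym (congr1 (@^~ b) (derive_comp_lin_fun u cl s2))) _.
by rewrite D1 derive_cst.
Qed.

(** * From vanishing third derivatives to polynomials in the coordinates *)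

Section Coordinates.
Context {R : realType} {S : quad_system R}.
Local Notation N := (1 + qs_ny S + qs_nz S)%N.

Definition of_coords (r : 'rV[R]_N) : base_space S :=
  ((lsubmx (lsubmx r)) 0 0, rsubmx (lsubmx r), rsubmx r).

Lemma of_coords_linear : linear of_coords.
Proof.
move=> c r r'; rewrite /of_coords !linearP /= !mxE.
by [].
Qed.
HB.instance Definition _ :=
  GRing.isLinear.Build R _ (base_space S) *:%R of_coords of_coords_linear.

Lemma base_coordsK (q : jet_space S) : of_coords (base_coords q) = q.1.
Proof.
rewrite /of_coords /base_coords !row_mxKl !row_mxKr mxE eqxx mulr1n /cx.
by case: q => [[[x y] z] p].
Qed.

Lemma derive0_quadratic_poly (f : base_space S -> R) : smooth f ->
  (forall u v w b, 'D_u (fun x => 'D_v (fun x => 'D_w f x) x) b = 0) ->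
  exists2 g, quadratic_poly g & forall r : 'rV[R]_N, f (of_coords r) = g r.
Proof.
move=> sf f3.
pose E k := of_coords (delta_mx 0 k).
have expand (g : base_space S -> R) r : smooth g ->
    'D_(of_coords r) g 0 = \sum_k r 0 k * 'D_(E k) g 0.
  move=> sg; have dg : differentiable g 0 by exact: smooth_diff.
  rewrite deriveE// {1}[r]row_sum_delta !linear_sum; apply: eq_bigr => k _.
  by rewrite !linearZ_LR deriveE.
exists (fun r => f 0 + \sum_k 'D_(E k) f 0 * r 0 k
   + 2^-1 * \sum_k \sum_j 'D_(E j) (fun x => 'D_(E k) f x) 0 * (r 0 k * r 0 j)).
  apply: quadratic_polyD; last first.
    apply: quadratic_polyZ; apply: quadratic_poly_sum => k; apply: quadratic_poly_sum => j.
    exact/quadratic_polyZ/quadratic_poly_coord2.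
  apply: quadratic_polyD; first exact: quadratic_poly_cst.
  by apply: quadratic_poly_sum => k; exact/quadratic_polyZ/quadratic_poly_coord.
move=> r; have s1 := smooth_derive (of_coords r) sf.
apply: etrans (taylor2 sf (f3 _ _ _)) _.
apply: (congr2 +%R); first apply: (congr1 (+%R (f 0))).
  by rewrite expand//; apply: eq_bigr => k _; rewrite mulrC.
apply: (congr1 ( *%R 2^-1)).
apply: etrans (expand _ r s1) _; apply: eq_bigr => k _.
(* Commuting the derivatives makes the direction [of_coords r] the outer one, so that [expand]
   applies a second time. *)
apply: etrans (congr1 ( *%R (r 0 k)) (derive_comm (E k) (of_coords r) sf 0)) _.
apply: etrans (congr1 ( *%R (r 0 k)) (expand _ r (smooth_derive (E k) sf))) _.
rewrite mulr_sumr; apply: eq_bigr => j _; rewrite mulrA; exact: mulrC.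
Qed.

End Coordinates.

(** * The listed systems and the conclusion *)

Lemma rigid_listed_system (R : realType) (l : nat) (S : quad_system R) :
  (3 <= l)%N -> listed_system l S -> rigid S.
Proof.
move=> hl [||kappa ksym kunit|kappa ksym kunit].
- by case: l hl => [|[|[|k]]] // _; exact: rigid_systemI.
- by apply: rigid_systemII; exact: ltnW.
- by apply: rigid_system_kappa => //; rewrite subn_gt0; lia.
- by apply: rigid_system_kappa => //; rewrite subn_gt0; lia.
Qed.

(** At [l] = 3 the numbers l - 1, 2l - 3, 2l - 4 are 2, 3, 2, and they grow with [l]. *)
Lemma listed_system_ny_gt1 (R : realType) (l : nat) (S : quad_system R) :
  (3 <= l)%N -> listed_system l S -> (1 < qs_ny S)%N.
Proof. by move=> hl [||kappa _ _|kappa _ _] /=; lia. Qed.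

Theorem mainTheorem3 (R : realType) (l : nat) (S : quad_system R)
    (X : jet_space S -> jet_space S) (hl : (3 <= l)%N) (hS : listed_system l S)
    (hX : infinitesimal_symmetry X) :
  let A := fun q => cx (X q) in
  let B := fun i q => cy i (X q) in
  let C := fun a q => cz a (X q) in
  let D := fun i q => cp i (X q) in
  [/\ [/\ indep_of_ydot A, forall i, indep_of_ydot (B i)
        & forall a, indep_of_ydot (C a)],
      forall i q, D i q = Dx (B i) q - cp i q * Dx A q
    & [/\ quadratic_in_base A, forall i, quadratic_in_base (B i)
        & forall a, quadratic_in_base (C a)]].
Proof.
move=> A B C D.
have ny := listed_system_ny_gt1 hl hS.
have sY := smooth_base_field hX.
have Y3 := rigid_derive3_eq0 sY (rigid_listed_system hl hS)
  (fun a p b => psi_derive_base_field hX ny a p b).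
have indep (f : jet_space S -> R) (l' : base_space S -> R) :
    (forall q, f q = l' (X q).1) -> indep_of_ydot f.
  move=> fE q q' e; rewrite !fE !(base_fieldE hX ny); congr (l' (base_field X _)).
  by rewrite -!base_coordsK e.
have quadratic (l' : {linear base_space S -> R}) : continuous l' ->
    quadratic_in_base (fun q => l' (X q).1).
  move=> cl; have sf : smooth (l' \o base_field X) by exact: smooth_lin_comp.
  (* A continuous linear form commutes with each of the three derivatives, so this reduces to
     [Y3]. *)
  have f3 u v w b : 'D_u (fun x => 'D_v (fun x => 'D_w (l' \o base_field X) x) x) b = 0.
    have s1 := smooth_derive w sY; have s2 := smooth_derive v s1.
    have e1 := derive_comp_lin_fun w cl sY.
    have e2 := derive_comp_lin_fun v cl s1.
    have e3 := congr1 (@^~ b) (derive_comp_lin_fun u cl s2).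
    apply: etrans (congr1 (fun g => 'D_u (fun x => 'D_v g x) b) e1) _.
    apply: etrans (congr1 (fun g => 'D_u g b) e2) _.
    apply: etrans e3 _; apply: etrans (congr1 l' (Y3 u v w b)) _.
    exact: linear0.
  have [g [P [sP gP]] fg] := derive0_quadratic_poly sf f3.
  exists P; split=> // q; rewrite -gP -fg /= base_coordsK.
  by rewrite (base_fieldE hX ny).
split.
- split=> [|i|a].
  + exact: (indep A bx).
  + exact: (indep (B i) (by_ i)).
  + exact: (indep (C a) (bz a)).
- exact: symmetry_prolongation hX.
- split=> [|i|a].
  + exact: (quadratic bx continuous_bx).
  + exact: (quadratic (by_ i) (@continuous_by _ _ i)).
  + exact: (quadratic (bz a) (@continuous_bz _ _ a)).
Qed.
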